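(* Let $n<\omega$, let $\alpha_0,\dots,\alpha_n$ be ordinals and let $\beta_0,\dots,\beta_n$ be pairwise distinct ordinals (all ordinals $<\omega_2$). Then $$\varphi\, d\big(\{(\alpha_i,\underline{\beta_i}):0\le i\le n\}\big)=\varphi^*\big((\alpha_0)_{\beta_0},(\alpha_1)_{\beta_1},\dots,(\alpha_n)_{\beta_n}\big),$$ where $\underline{\beta}=\{(\beta,\emptyset)\}$, $d$ recursively erases zeros, $\varphi$ is the dimensional Veblen function, and $\varphi^*$ is the (Schütte-style) transfinitary Veblen function, with entry $\alpha_i$ at position $\beta_i$ and entry $0$ at all other positions.
   Context: Throughout $\mathrm{Ord}$ denotes $\omega_2$ (the initial ordinal of $\aleph_2$). In definitions by cases, if several cases apply, the first listed takes priority. **Arrays.** A relation $R$ is injective if $(x,y),(z,w)\in R$ implies $x=z$ or $y\neq w$. Put $A_0=\{\emptyset\}$, and let $A_{n+1}$ be the set of all nonempty finite injective relations $X\subseteq(\mathrm{Ord}\setminus\{0\})\times(A_0\cup\dots\cup A_n)$. Let $A=\bigcup_{n<\omega}A_n$ and $A'=A\setminus\{\emptyset\}$. Define $B\supseteq A$ in the same way but with $0$ also allowed as a first coordinate at every stage. For $X\in A$: $a(X)=\{Y:\exists\alpha\,(\alpha,Y)\in X\}$; $c_X(Y)$ is the unique $\alpha$ with $(\alpha,Y)\in X$ if $Y\in a(X)$, and $c_X(Y)=0$ otherwise. Simultaneously define $b,\bar b:A'\to A$ and a relation $\prec$ on $A$: $b(X)$ is the unique $X'\in a(X)$ such that $X'\prec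 X''$ for no $X''\in a(X)$; $\bar b(X)$ is the unique $X'\in a(X)$ such that $X''\prec X'$ for no $X''\in a(X)$; and: 1. if $Y=\emptyset$, $X\prec Y$ is false; 2. else if $X=\emptyset$, $X\prec Y$ is true; 3. else if $b(X)\ne b(Y)$, $X\prec Y$ iff $b(X)\prec b(Y)$; 4. else if $c_X(b(X))\neq c_Y(b(Y))$, $X\prec Y$ iff $c_X(b(X))<c_Y(b(Y))$; 5. else $X\prec Y$ iff $X\setminus\{(c_X(b(X)),b(X))\}\prec Y\setminus\{(c_Y(b(Y)),b(Y))\}$. **Auxiliary functions.** For $X\in B$, $d(X)=\{(\alpha,d(Y)):(\alpha,Y)\in X,\ \alpha>0\}\in A$ (recursively erasing zeros; in particular $d(\underline{0})=\emptyset$). For $X\in A$: $e(X)=X$ if $c_X(\emptyset)$ is $0$ or a limit; if $c_X(\emptyset)=\eta+1$, then $e(X)=d\big((X\setminus\{(c_X(\emptyset),\emptyset)\})\cup\{(\eta,\emptyset)\}\big)$. $f:A\to\mathrm{Ord}$ is defined recursively: 1. $f(\emptyset)=0$; 2. if $e(X)\ne X$, $f(X)=1$; 3. if $c_X(\bar b(X))$ is a successor: (a) if $e(\bar b(X))\neq\bar b(X)$, $f(X)=2$; (b) else $f(X)=f(\bar b(X))$; 4. else $f(X)=c_X(\bar b(X))$. $g(X,\alpha)\in A$ for $X\in A$, $\alpha\in\mathrm{Ord}$ is defined recursively: 1. $g(\emptyset,\alpha)=\emptyset$; 2. if $e(X)\neq X$, $g(X,\alpha)=e(X)$; 3. if $c_X(\bar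 b(X))=\eta+1$, put $X^-=X\setminus\{(c_X(\bar b(X)),\bar b(X))\}$: (a) if $e(\bar b(X))\ne\bar b(X)$, $g(X,\alpha)=d(X^-\cup\{(\eta,\bar b(X)),(\alpha,e(\bar b(X)))\})$; (b) else $g(X,\alpha)=d(X^-\cup\{(\eta,\bar b(X)),(1,g(\bar b(X),\alpha))\})$; 4. else $g(X,\alpha)=d\big((X\setminus\{(c_X(\bar b(X)),\bar b(X))\})\cup\{(\alpha,\bar b(X))\}\big)$. $h(X)=X\setminus\{(c_X(\emptyset),\emptyset)\}$ if $\emptyset\in a(X)$, and $h(X)=X$ otherwise (so $h(\emptyset)=\emptyset$). **Dimensional Veblen function** $\varphi:A\to\mathrm{Ord}$: $\varphi\emptyset=1$; if $a(X)=\{\emptyset\}$, $\varphi X=\omega^{c_X(\emptyset)}$; otherwise $\varphi X=\operatorname{enum}(U)(c_X(\emptyset))$, where $\operatorname{enum}(U)$ is the increasing enumeration of $U\subseteq\mathrm{Ord}$ starting at index $0$, and - if $f(h(X))>2$, $U=\{\alpha:\forall\beta\,(0<\beta<f(h(X))\Rightarrow\alpha=\varphi\,d(g(h(X),\beta)\cup\{(\alpha,\emptyset)\}))\}$; - if $f(h(X))=2$, $U=\{\alpha:\alpha=\varphi\,g(h(X),\alpha)\}$. **The function $\varphi^*$.** Its argument is a finitely supported assignment of ordinals (entries) to ordinal positions; $(\alpha)_\beta$ (or $\alpha_\beta$) denotes entry $\alpha$ at position $\beta$, and unlisted positions have entry $0$. If all positions other than $0$ have entry $0$ and position $0$ has entry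 $\alpha$, then $\varphi^*=\omega^{\alpha}$. Otherwise, let $\sigma$ be the assignment, $\alpha_0$ its entry at position $0$, $\beta>0$ the least positive position with nonzero entry, and $\alpha_\beta$ that entry. Then $\varphi^*(\sigma)$ is the $\alpha_0$-th (counting from $0$) ordinal $\eta$ such that for all $\delta<\beta$ and all $\alpha'<\alpha_\beta$, $\eta=\varphi^*(\sigma_{\delta,\alpha',\eta})$, where $\sigma_{\delta,\alpha',\eta}$ has entry $\eta$ at position $\delta$, entry $0$ at all other positions below $\beta$, entry $\alpha'$ at position $\beta$, and agrees with $\sigma$ at all positions above $\beta$. *)

(* Defs.v *)
From HB Require Import structures.
From mathcomp Require Import all_boot all_order finmap zify.
From mathcomp Require Import boolp classical_sets functions cardinality wochoice.

Set Implicit Arguments.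
Unset Strict Implicit.
Unset Printing Implicit Defensive.

Import Order.TTheory.

Local Open Scope classical_set_scope.
Local Open Scope order_scope.

(* Recursion along [R]; recursive calls of [F] that are not [R]-below the
   current argument get the value [dflt]. *)
HB.lock Definition wfrec {T S : Type} (R : T -> T -> Prop) (dflt : S)
    (F : (T -> S) -> T -> S) (x : T) : S :=
  match pselect (Acc R x) with
  | left acc =>
      Fix_F (fun=> S)
        (fun y rec => F (fun z => match pselect (R z y) with
                                  | left Rzy => rec z Rzy
                                  | right _ => dflt
                                  end) y) acc
  | right _ => dflt
  end.

Lemma wfrecE (T S : Type) (R : T -> T -> Prop) (dflt : S) F (x : T) :
  Acc R x ->
  wfrec R dflt F x =
    F (fun z => if pselect (R z x) then wfrec R dflt F z else dflt) x.
Proof.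
move=> accx; rewrite {1}wfrec.unlock; case: pselect => // a.
case: a => a /=; congr F; apply/funext => z; case: pselect => //= Rzx.
rewrite wfrec.unlock; case: pselect => [az|]; last by move/(_ (a z Rzx)).
by rewrite (Prop_irrelevance az (a z Rzx)).
Qed.

Section WellOrderedAlias.
Variable T : Type.

Definition wellordered := T.

HB.instance Definition _ := gen_eqMixin wellordered.
HB.instance Definition _ := gen_choiceMixin wellordered.

Definition wo_rel : rel wellordered :=
  sval (well_ordering_principle wellordered).

Lemma wo_relP : well_order wo_rel.
Proof. exact: svalP (well_ordering_principle wellordered). Qed.

Let wo_chain_rel : wo_chain wo_rel predT.
Proof. exact: (withinW wo_relP (A := predT)). Qed.

Let wo_refl : reflexive wo_rel.
Proof. by move=> x; apply: (wo_chain_reflexive wo_chain_rel). Qed.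

Let wo_anti : antisymmetric wo_rel.
Proof. by move=> x y; apply: (wo_chain_antisymmetric wo_chain_rel). Qed.

Let wo_total : total wo_rel.
Proof. by move=> x y; apply: (wo_chainW wo_chain_rel). Qed.

Let wo_trans : transitive wo_rel.
Proof.
move=> y x z xy yz.
have [|m [[mA mmin] _]] := wo_relP (A := [pred u | u \in [:: x; y; z]]).
  by exists x; rewrite !inE eqxx.
have mP u : u \in [:: x; y; z] -> wo_rel m u by exact: mmin.
move: mA; rewrite !inE => /or3P[] /eqP me; subst m.
- by apply: mP; rewrite !inE eqxx !orbT.
- have := mP x; rewrite !inE eqxx => /(_ isT) yx.
  by rewrite (wo_anti (introT andP (conj xy yx))).
- have := mP y; rewrite !inE eqxx orbT => /(_ isT) zy.
  by rewrite -(wo_anti (introT andP (conj yz zy))).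
Qed.

HB.instance Definition _ :=
  Order.Le_isPOrder.Build (Order.Disp tt tt) wellordered wo_refl wo_anti wo_trans.
HB.instance Definition _ :=
  Order.POrder_isTotal.Build (Order.Disp tt tt) wellordered wo_total.

Lemma wellordered_min (A : set wellordered) :
  A !=set0 -> exists2 x, A x & forall y, A y -> x <= y.
Proof.
case=> x Ax; have [|m [[mA mmin] _]] := wo_relP (A := [pred u | `[< A u >]]).
  by exists x; apply/asboolP.
by exists m => [|y Ay]; [apply/asboolP | apply: mmin; apply/asboolP].
Qed.

End WellOrderedAlias.

Section Hartogs.
Variable T : Type.

Definition small_segment (s : wellordered (set T)) : bool :=
  `[< ([set s' | (s' < s)%O] #<= [set: T])%card >].

Definition hartogs := {s : wellordered (set T) | small_segment s}.

HB.instance Definition _ := SubChoice.on hartogs.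
HB.instance Definition _ :=
  [SubChoice_isSubOrder of hartogs by <: with (Order.Disp tt tt)].

End Hartogs.

Section HartogsTheory.
Variable T : Type.
Implicit Types (x y : hartogs T) (A : set (hartogs T)).

Lemma hartogs_min A : A !=set0 -> exists2 x, A x & forall y, A y -> x <= y.
Proof.
case=> x0 Ax0; have [|_ [x Ax <-] xmin] := @wellordered_min _ (val @` A).
  by exists (val x0), x0.
by exists x => // y Ay; apply: xmin; exists y.
Qed.

Lemma hartogs_segment x : ([set y | (y < x)%O] #<= [set: T])%card.
Proof.
have segP := asboolW (valP x).
rewrite -(card_le_eql (@inj_card_eq _ _ [set y | y < x] val _)); last first.
  by move=> ? ? _ _; apply: val_inj.
apply: card_le_trans segP; apply: subset_card_le => _ [y yx <-].
  exact: yx.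
Qed.

Lemma hartogs_not_le : ~ ([set: hartogs T] #<= [set: T])%card.
Proof.
move=> leT; have imT : ((val @` [set: hartogs T]) #<= [set: T])%card.
  exact: card_le_trans (card_image_le _ _) leT.
pose large := [set s : wellordered (set T) | ~~ small_segment s].
have [largeN0|small] := pselect (large !=set0).
  have [s0 s0large s0min] := wellordered_min largeN0.
  move/negP: s0large; apply; apply/asboolP; apply: (card_le_trans _ imT).
  apply: subset_card_le => s ss0; have [ssmall|slarge] := boolP (small_segment s).
    by exists (exist _ s ssmall).
  by have := s0min s slarge; rewrite leNgt ss0.
have {}small (s : wellordered (set T)) : small_segment s.
  by apply/negPn/negP => slarge; apply: small; exists s.
have {imT} /card_leP[f] : ([set: wellordered (set T)] #<= [set: T])%card.
  by apply: (card_le_trans _ imT); apply: subset_card_le => s _;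
    exists (exist _ s (small s)).
pose i (s : set T) : T := val (f (SigSub (mem_set (I : setT (s : wellordered _))))).
have iI : injective i.
  move=> s t /val_inj st.
  have := @inj _ _ _ f _ _ (mem_set I) (mem_set I) st.
  by move/(congr1 val).
pose D : set T := [set t | exists2 s, i s = t & ~ s t].
have [DiD|DiD] := pselect (D (i D)); first by case: (DiD) => s /iI ->; exact.
by apply: (DiD); exists D.
Qed.

End HartogsTheory.

(* [hartogs T] is the initial ordinal of the successor cardinal of [T]. *)
Definition omega1 := hartogs nat.
Definition Ord := hartogs omega1.

HB.instance Definition _ := Order.Total.on Ord.

Lemma Ord_wf : well_founded (fun x y : Ord => x < y).
Proof.
move=> x; apply: contrapT => xN.
have [y yN ymin] : exists2 y : Ord, ~ Acc (fun x y : Ord => x < y) y &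
    forall z, ~ Acc (fun x y : Ord => x < y) z -> y <= z.
  by apply: (@hartogs_min _ [set y | ~ Acc _ y]); exists x.
apply: yN; split=> z zy; apply: contrapT => zN.
by have := ymin z zN; rewrite leNgt zy.
Qed.

Lemma exists_ozero : exists x : Ord, forall y : Ord, x <= y.
Proof.
have [|x _ xmin] := @hartogs_min _ [set: Ord]; last by exists x => y; apply: xmin.
apply/set0P/negP => /eqP E0; apply: (@hartogs_not_le omega1).
by rewrite -/Ord E0.
Qed.

Definition ozero : Ord := sval (cid exists_ozero).

Definition least (S : set Ord) : Ord :=
  xget ozero [set x | S x /\ forall y, S y -> x <= y].

Definition osup (S : set Ord) : Ord := least [set x | forall y, S y -> y <= x].

Definition osucc (x : Ord) : Ord := least [set y | x < y].

Definition opred (x : Ord) : option Ord :=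
  if pselect (exists y, x = osucc y) is left ex then Some (sval (cid ex))
  else None.

Definition is_limit (x : Ord) : Prop := x <> ozero /\ opred x = None.

Definition oone := osucc ozero.
Definition otwo := osucc oone.

Definition orec (z : Ord) (s : Ord -> Ord) : Ord -> Ord :=
  wfrec (fun x y : Ord => x < y) ozero (fun rec b =>
    if b == ozero then z
    else if opred b is Some c then s (rec c)
    else osup [set rec c | c in [set c | c < b]]).

Definition oadd (x : Ord) : Ord -> Ord := orec x osucc.
Definition omul (x : Ord) : Ord -> Ord := orec ozero (fun y => oadd y x).
Definition oexp (x : Ord) : Ord -> Ord := orec oone (fun y => omul y x).
Definition omega : Ord := least [set x | is_limit x].

Definition enum (U : set Ord) : Ord -> Ord :=
  wfrec (fun x y : Ord => x < y) ozero (fun rec a =>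
    least [set x | U x /\ forall c, c < a -> rec c < x]).

(* Hereditarily finite relations between ordinals and such relations: trees all
   of whose nodes carry the canonical enumeration of a finite set. *)
Inductive tree := Node of seq (Ord * tree).

HB.instance Definition _ := gen_eqMixin tree.
HB.instance Definition _ := gen_choiceMixin tree.

Fixpoint hcanonical (t : tree) : bool :=
  let: Node s := t in canonical_keys s && all (fun p => hcanonical p.2) s.

Definition hrel := {t : tree | hcanonical t}.
HB.instance Definition _ := SubChoice.on hrel.

Definition children (t : tree) : seq (Ord * tree) := let: Node s := t in s.

Fact hcanonical_nil : hcanonical (Node [::]).
Proof. by rewrite /= /canonical_keys sort_keys_nil eqxx. Qed.

Definition emptyrel : hrel := exist _ (Node [::]) hcanonical_nil.

HB.lock Definition elts (X : hrel) : {fset (Ord * hrel)} :=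
  seq_fset tt [seq (p.1, insubd emptyrel p.2) | p <- children (val X)].

Coercion elts : hrel >-> finset_of.

Lemma in_elts X p :
  (p \in elts X) = (p \in [seq (q.1, insubd emptyrel q.2) | q <- children (val X)]).
Proof. by rewrite elts.unlock; exact: seq_fsetE. Qed.

Fact hcanonical_rel (s : {fset (Ord * hrel)}) :
  hcanonical (Node (enum_fset [fset (p.1, val p.2) | p in s]%fset)).
Proof.
rewrite /= keys_canonical /=; apply/allP => _ /imfsetP[p _ ->] /=; exact: valP.
Qed.

HB.lock Definition rel_of (s : {fset (Ord * hrel)}) : hrel :=
  exist _ (Node (enum_fset [fset (p.1, val p.2) | p in s]%fset)) (hcanonical_rel s).

Lemma elts_rel_of : cancel rel_of elts.
Proof.
move=> s; apply/fsetP => -[a X]; rewrite in_elts rel_of.unlock.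
apply/mapP/idP => [[_ /imfsetP[[b Y] Ys ->] /= [-> ->]]|Xs].
  by rewrite valKd.
by exists (a, val X); [apply/imfsetP; exists (a, X) | rewrite /= valKd].
Qed.

Lemma rel_of_elts : cancel elts rel_of.
Proof.
move=> [[s] sP]; apply: val_inj; rewrite rel_of.unlock /=; congr Node.
have /andP[/eqP s_can /allP s_sub] := sP.
rewrite -[RHS]s_can; set F := [fset _ | _ in _]%fset.
rewrite -(eqP (keys_canonical F)); apply/eq_sort_keys => -[a t].
apply/imfsetP/idP => [[[b Y]]|ts].
  rewrite in_elts => /mapP[[c u] us /= [-> ->]] [-> ->].
  by rewrite insubdK //; apply: (s_sub _ us).
exists (a, insubd emptyrel t); last by rewrite insubdK //; apply: (s_sub _ ts).
by rewrite /= in_elts; apply/mapP; exists (a, t).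
Qed.

Fixpoint tree_weight (t : tree) : nat :=
  let: Node s := t in sumn [seq 3 ^ tree_weight p.2 | p <- s].

(* Chosen so that [weight Y + weight Z < weight X] for [Y] and [Z] second
   coordinates of [X], see [weight_pair]. *)
Definition weight (X : hrel) : nat := tree_weight (val X).

Lemma weightE (X : hrel) : weight X = (\sum_(p <- X) 3 ^ weight p.2)%N.
Proof.
rewrite -{1}[X]rel_of_elts /weight rel_of.unlock /= sumnE big_map /=.
rewrite (perm_big [seq (p.1, val p.2) | p <- X]); last first.
  apply: uniq_perm; first exact: fset_uniq.
    rewrite map_inj_uniq ?fset_uniq // => -[a Y] [b Z] /= [-> /val_inj ->] //.
  move=> q; apply/imfsetP/mapP => -[p pX ->]; by exists p.
by rewrite big_map.
Qed.

Definition dom (X : hrel) : {fset hrel} := [fset p.2 | p in elts X]%fset.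

Lemma domP (X Y : hrel) : reflect (exists a, (a, Y) \in elts X) (Y \in dom X).
Proof.
apply: (iffP (imfsetP _ _ _ _)) => [[[a Z] /= XZ ->]|[a XY]]; first by exists a.
by exists (a, Y).
Qed.

Lemma weight_elt (X : hrel) p : p \in elts X -> (3 ^ weight p.2 <= weight X)%N.
Proof.
by move=> pX; rewrite (weightE X) (big_rem p) //= leq_addr.
Qed.

Lemma weight_dom (X Y : hrel) : Y \in dom X -> (weight Y < weight X)%N.
Proof. by case/domP => a /weight_elt; apply: leq_trans; apply: ltn_expl. Qed.

Lemma weight_pair (X Y Z : hrel) :
  Y \in dom X -> Z \in dom X -> (weight Y + weight Z < weight X)%N.
Proof.
have ltn3 n : (n + n < 3 ^ n)%N.
  elim: n => // n IH; rewrite expnS !addSn !addnS.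
  have : (0 < 3 ^ n)%N by rewrite expn_gt0.
  by move: IH; move: (n + n)%N (3 ^ n)%N => a b; lia.
wlog YZ : Y Z / (weight Y <= weight Z)%N => [H YX ZX|].
  by case: (leqP (weight Y) (weight Z)) => [/H|/ltnW/H]; last rewrite addnC; apply.
move=> _ /domP[a /weight_elt]; apply: leq_trans.
by apply: leq_ltn_trans (ltn3 _); rewrite leq_add2r.
Qed.

(* [stage P n] is A_0 U ... U A_n with first coordinates satisfying [P]. *)
Fixpoint stage (P : set Ord) (n : nat) : set hrel :=
  if n is n'.+1 then
    stage P n' `|`
    [set X : hrel |
      [/\ X <> emptyrel,
          forall x y z w, (x, y) \in elts X -> (z, w) \in elts X ->
            x = z \/ y <> w &
          forall x y, (x, y) \in elts X -> P x /\ stage P n' y]]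
  else [set emptyrel].

Definition arrays : set hrel := \bigcup_n stage [set x | x <> ozero] n.
Definition zarrays : set hrel := \bigcup_n stage setT n.

Definition coef (X Y : hrel) : Ord := xget ozero [set a | (a, Y) \in elts X].

HB.lock Definition remove (X Y : hrel) : hrel := rel_of (elts X `\ (coef X Y, Y))%fset.

HB.lock Definition adjoin (p : Ord * hrel) (X : hrel) : hrel := rel_of (p |` elts X)%fset.

Definition last_dom (r : rel hrel) (X : hrel) : hrel :=
  xget emptyrel [set Y | Y \in dom X /\ forall Z, Z \in dom X -> ~~ r Y Z].

Definition first_dom (r : rel hrel) (X : hrel) : hrel :=
  xget emptyrel [set Y | Y \in dom X /\ forall Z, Z \in dom X -> ~~ r Z Y].

Definition weight_lt (p q : hrel * hrel) : Prop :=
  (weight p.1 + weight p.2 < weight q.1 + weight q.2)%N.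

Definition prec_body (rec : hrel * hrel -> bool) (p : hrel * hrel) : bool :=
  let: (X, Y) := p in
  let b := last_dom (fun U V => rec (U, V)) in
  if Y == emptyrel then false
  else if X == emptyrel then true
  else if b X != b Y then rec (b X, b Y)
  else if coef X (b X) != coef Y (b Y) then coef X (b X) < coef Y (b Y)
  else rec (remove X (b X), remove Y (b Y)).

Definition prec (X Y : hrel) : bool :=
  wfrec weight_lt false prec_body (X, Y).

Definition arr_b : hrel -> hrel := last_dom prec.
Definition arr_bbar : hrel -> hrel := first_dom prec.

Definition below_dom (Y X : hrel) : Prop := Y \in dom X.

Definition arr_d : hrel -> hrel :=
  wfrec below_dom emptyrel (fun rec X =>
    rel_of [fset (p.1, rec p.2) | p in [fset p in elts X | (ozero < p.1)%O]]%fset).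

Definition arr_e (X : hrel) : hrel :=
  if opred (coef X emptyrel) is Some c then
    arr_d (adjoin (c, emptyrel) (remove X emptyrel))
  else X.

Definition arr_f : hrel -> Ord :=
  wfrec below_dom ozero (fun rec X =>
    if X == emptyrel then ozero
    else if arr_e X != X then oone
    else if opred (coef X (arr_bbar X)) is Some _ then
      if arr_e (arr_bbar X) != arr_bbar X then otwo else rec (arr_bbar X)
    else coef X (arr_bbar X)).

Definition arr_g : hrel -> Ord -> hrel :=
  wfrec below_dom (fun=> emptyrel) (fun rec X a =>
    if X == emptyrel then emptyrel
    else if arr_e X != X then arr_e X
    else if opred (coef X (arr_bbar X)) is Some c then
      let X' := adjoin (c, arr_bbar X) (remove X (arr_bbar X)) in
      if arr_e (arr_bbar X) != arr_bbar X then arr_d (adjoin (a, arr_e (arr_bbar X)) X')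
      else arr_d (adjoin (oone, rec (arr_bbar X) a) X')
    else arr_d (adjoin (a, arr_bbar X) (remove X (arr_bbar X)))).

Definition arr_h (X : hrel) : hrel :=
  if emptyrel \in dom X then remove X emptyrel else X.

Definition veblen_set (v : hrel -> Ord) (X : hrel) : set Ord :=
  if otwo < arr_f (arr_h X) then
    [set a | forall c, ozero < c -> c < arr_f (arr_h X) ->
       a = v (arr_d (adjoin (a, emptyrel) (arr_g (arr_h X) c)))]
  else if arr_f (arr_h X) == otwo then [set a | a = v (arr_g (arr_h X) a)]
  else set0.

Definition phi : hrel -> Ord :=
  wfrec (fun Y X => arrays Y /\ prec (arr_h Y) (arr_h X)) ozero (fun rec X =>
    if X == emptyrel then oone
    else if dom X == [fset emptyrel]%fset then oexp omega (coef X emptyrel)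
    else enum (veblen_set rec X) (coef X emptyrel)).

Definition entries := {fsfun Ord -> Ord with ozero}.

Definition least_pos (s : entries) : Ord :=
  least [set x | ozero < x /\ s x <> ozero].

Definition entries_set (s : entries) (x a y : Ord) : entries :=
  [fsfun z in (x |` (least_pos s |` finsupp s))%fset =>
     if z == x then y
     else if (z < least_pos s)%O then ozero
     else if z == least_pos s then a
     else s z | ozero].

Definition phistar : entries -> Ord :=
  wfrec (fun t s : entries => exists x, [/\ ozero < x, t x < s x &
                                forall y, x < y -> t y = s y]) ozero
    (fun rec s =>
      if (finsupp s `<=` [fset ozero])%fset then oexp omega (s ozero)
      else enum [set y | forall x a, x < least_pos s -> a < s (least_pos s) ->
                   y = rec (entries_set s x a y)] (s ozero)).

Definition underline (x : Ord) : hrel := rel_of [fset (x, emptyrel)]%fset.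

Definition entries_of (n : nat) (al be : 'I_n -> Ord) : entries :=
  [fsfun x in [fset be i | i : 'I_n]%fset =>
     if [pick i | be i == x] is Some i then al i else ozero | ozero].

(* Main.v *)
Require Import Defs.
From mathcomp Require Import all_boot all_order finmap zify.
From mathcomp Require Import boolp classical_sets functions cardinality.

(** Arrays whose keys all have the form [underline x] are finitely supported
    assignments of entries to positions in disguise ([array_of]); the key of
    position [ozero] is the empty array.  Under this dictionary [prec] compares
    two assignments at the greatest position where they differ ([prec_lex],
    [lex_prec]), so [phi] and [phistar] recurse along the same well-founded
    order, and [arr_h] forgets the entry at position [ozero].

    Both functions then send [s] to the [s ozero]-th element of a set of common
    fixed points attached to the positive part of [s].  Let [b] be the least
    positive position with a nonzero entry.  The set [values s] of [phistar]
    consists of the [y] fixed by every way of lowering the entry at [b] to some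
    [a] and putting [y] at some position [d < b].  The set of [phi] follows a
    fundamental sequence given by [arr_f] and [arr_g], and asks for fewer
    equations:
    - if [b] is [osucc h] and its entry is [osucc c], the single equation with
      [c] at [b] and [y] at [h];
    - if [b] is a limit and its entry is [osucc c], the equations with [c] at
      [b], [oone] at [x] and [y] at [ozero], for [0 < x < b];
    - if the entry is a limit, the equations with [x] at [b] and [y] at
      [ozero], for [x] positive and below that entry.
    The remaining equations follow, because each value of [phistar] belongs to
    the set that it enumerates: from [y = phistar t] one reads off all the
    equations attached to [t], and a few such steps ([fix_drop],
    [values_succ_succ], [values_lim_succ], [values_lim]) give all of [values s].

    What is left is that an enumeration does take its values in the set
    enumerated, that is, that every [values s] is unbounded.  This is proved by
    induction along [pos_lt], together with closedness under limits
    ([values_club]): an ordinal closed under the functions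
    [x |-> phistar (entries_set s d a x)], for all [d < b] and all [a] below
    the entry at [b], lies in [values s].  As these are at most omega1 many
    functions, such ordinals are cofinal in omega2 by its regularity
    ([ord_bound]), which itself rests on an injection of the square of omega1
    into omega1 ([hartogs_square]). *)

Set Implicit Arguments.
Unset Strict Implicit.
Unset Printing Implicit Defensive.

Import Order.TTheory.

Local Open Scope classical_set_scope.
Local Open Scope order_scope.
(* [fintype.enum] would otherwise hide the enumeration of a set of ordinals. *)
Local Notation enum := Defs.enum.
(* Keeps [done] from trying to compute weights. *)
#[local] Opaque weight.

(** * Regularity of the Hartogs ordinal of an infinite set *)

Definition inj_on (I S : Type) (D : set I) (e : I -> S) :=
  forall i j, D i -> D j -> e i = e j -> i = j.

Lemma card_le_inj (A B : Type) (f : A -> B) :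
  injective f -> ([set: A] #<= [set: B])%card.
Proof.
move=> fI; have e : ([set: A] #= (f @` [set: A]))%card.
  by rewrite card_eq_sym; apply: inj_card_eq => ? ? _ _; exact: fI.
by rewrite (card_le_eql e); apply: subset_card_le.
Qed.

Lemma hartogs_segment_inj (T : Type) (t0 : T) (x : hartogs T) :
  exists e : hartogs T -> T, inj_on [set y | y < x] e.
Proof.
have /card_leP[f] := hartogs_segment x.
exists (fun y => if pselect (y < x) is left yx
                 then \val (f (SigSub (mem_set (yx : [set y | y < x] y)))) else t0).
move=> y z /= yx zx; case: pselect => // yx'; case: pselect => // zx'.
set u := SigSub _; set v := SigSub _ => /(@val_inj _ _ _ (f u) (f v)) fuv.
by have /(congr1 val) := @inj _ _ _ f _ _ (mem_set I) (mem_set I) fuv.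
Qed.

Lemma hartogs_inj_le (T : Type) (f : hartogs T -> T) : ~ injective f.
Proof. by move=> /card_le_inj; apply: hartogs_not_le. Qed.

(** If [g] were unbounded on [D], every [b] would lie strictly below some [g i];
    coding [b] by [i] and by its place in the segment below [g i] would embed
    [hartogs T] into [T].  The injection [J] is what makes [T] big enough to
    hold such codes. *)
Lemma hartogs_bound (T : Type) (J : option (T * T) -> T) (I : Type) (D : set I)
    (e : I -> T) (g : I -> hartogs T) :
  injective J -> inj_on D e -> exists b, forall i, D i -> g i <= b.
Proof.
move=> JI eI; apply: contrapT => unb.
have {}unb b : exists i, D i /\ b < g i.
  apply: contrapT => nb; apply: unb; exists b => i Di.
  by rewrite leNgt; apply/negP => bg; apply: nb; exists i.
pose i b := sval (cid (unb b)).
have iP b : D (i b) /\ b < g (i b) by rewrite /i; case: cid.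
pose s x := sval (cid (hartogs_segment_inj (J None) x)).
have sP x : inj_on [set y | y < x] (s x) by rewrite /s; case: cid.
apply: (@hartogs_inj_le T (fun b => J (Some (e (i b), s (g (i b)) b)))).
move=> b c /JI [] /eI bc; have [Db bg] := iP b; have [Dc cg] := iP c.
have {}bc := bc Db Dc; rewrite bc in bg *.
by apply: sP.
Qed.

Lemma hartogs_no_max (T : Type) (J : option (T * T) -> T) (x : hartogs T) :
  injective J -> exists y, x < y.
Proof.
move=> JI; apply: contrapT => nmax.
have le_x y : y <= x by rewrite leNgt; apply/negP => xy; apply: nmax; exists y.
have [s sI] := hartogs_segment_inj (J None) x.
apply: (@hartogs_inj_le T (fun y => if y == x then J None else J (Some (s y, s y)))).
move=> y z; have [->|yx] := eqVneq y x; have [->|zx] := eqVneq z x => //; try by move/JI.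
by move=> /JI [] /sI yz _; apply: yz => /=; rewrite lt_neqAle ?yx ?zx le_x.
Qed.

Lemma hartogs_strict_bound (T : Type) (J : option (T * T) -> T) (I : Type)
    (D : set I) (e : I -> T) (g : I -> hartogs T) :
  injective J -> inj_on D e -> exists b, forall i, D i -> g i < b.
Proof.
move=> JI eI; have [b bP] := hartogs_bound g JI eI.
by have [c bc] := hartogs_no_max b JI; exists c => i /bP /le_lt_trans; apply.
Qed.

Lemma minimum_wf d (T : orderType d) :
  (forall A : set T, A !=set0 -> exists2 x, A x & forall y, A y -> x <= y) ->
  well_founded (fun x y : T => x < y).
Proof.
move=> Tmin x; apply: contrapT => xN.
have [|y yN ymin] := Tmin [set y | ~ Acc (fun x y : T => x < y) y]; first by exists x.
apply: yN; split=> z zy; apply: contrapT => zN.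
by have := ymin z zN; rewrite leNgt zy.
Qed.

Lemma hartogs_wf (T : Type) : well_founded (fun x y : hartogs T => x < y).
Proof. exact: minimum_wf (@hartogs_min T). Qed.

Lemma wellordered_wf (T : Type) : well_founded (fun x y : wellordered T => x < y).
Proof. exact: minimum_wf (@wellordered_min T). Qed.

(** A well-order of [hartogs T * option T] whose segments are small: the pairs
    below [(x, t)] have their first component at most [x]. *)
Definition lex_pair (T : Type) (p q : hartogs T * wellordered (option T)) : Prop :=
  p.1 < q.1 \/ p.1 = q.1 /\ p.2 < q.2.

Lemma lex_pair_wf T : well_founded (@lex_pair T).
Proof.
move=> [x t]; elim/(well_founded_induction (@hartogs_wf T)): x t => x IHx t.
elim/(well_founded_induction (@wellordered_wf (option T))): t => t IHt.
by split=> -[y u] [/= yx|/= [-> ut]]; [apply: IHx | apply: IHt].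
Qed.

Lemma lex_pair_total T (p q : hartogs T * wellordered (option T)) :
  [\/ p = q, lex_pair p q | lex_pair q p].
Proof.
case: p q => [x t] [y u]; rewrite /lex_pair /=.
have [xy|yx|->] := ltgtP x y; [by apply: Or32; left|by apply: Or33; left|].
have [tu|ut|->] := ltgtP t u; [|by apply: Or33; right|by apply: Or31].
by apply: Or32; right.
Qed.

(** The property assumed of [T] passes to [hartogs T].  A pair [(x, y)] is
    determined by a strict upper bound [m] and the two places in the segment
    below [m], hence by an element of [hartogs T * option T].  That product
    embeds into [hartogs T] by ranking it lexicographically: each rank is a
    strict bound of the earlier ones, and exists because segments are small. *)
Lemma hartogs_square (T : Type) (J : option (T * T) -> T) : injective J ->
  exists J' : option (hartogs T * hartogs T) -> hartogs T, injective J'.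
Proof.
move=> JI.
have t0 : T := J None.
have seg x := hartogs_segment_inj t0 x.
have nomax x := hartogs_no_max x JI.
(* A bound of the empty family is just some element of [hartogs T]. *)
have [h0 _] := @hartogs_bound T J Empty_set set0 (fun i => match i with end)
  (fun i => match i with end) JI (fun i => match i with end).
pose suc x := sval (cid (nomax x)); have sucP x : x < suc x by rewrite /suc; case: cid.
pose s x := sval (cid (seg x)).
have sP x : inj_on [set y | y < x] (s x) by rewrite /s; case: cid.
pose jo (t : option T) : T := J (omap (fun t => (t, t)) t).
have joI : injective jo by move=> [t|] [u|] /JI // [->].
pose bnd p (r : _ -> hartogs T) := [set b | forall q, @lex_pair T q p -> r q < b].
have bndP p r : exists b, bnd p r b.
  apply: (hartogs_strict_bound (D := [set q | lex_pair q p])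
           (e := fun q => J (Some (s (suc p.1) q.1, jo q.2))) r JI).
  have below q : lex_pair q p -> q.1 < suc p.1.
    by case=> [qp|[-> _]]; [exact: lt_trans qp (sucP _) | exact: sucP].
  by move=> [x t] [y u] /below xp /below yp /JI [] /sP xy /joI ->; congr pair; apply: xy.
pose rank := wfrec (@lex_pair T) h0 (fun r p => xget h0 (bnd p r)).
have rankP p q : lex_pair q p -> rank q < rank p.
  move=> qp; rewrite [rank p]wfrecE; last exact: lex_pair_wf.
  set r := fun z => _; have /(_ q qp) := xgetPex h0 (bndP p r).
  by rewrite {1}/r; case: pselect.
have rankI : injective rank.
  move=> p q pq; have [//|/rankP|/rankP] := lex_pair_total p q; by rewrite pq ltxx.
clearbody rank; clear bnd bndP rankP jo joI.
pose m (x y : hartogs T) := suc (Order.max x y).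
have mP x y : x < m x y /\ y < m x y.
  by have := sucP (Order.max x y); rewrite gt_max => /andP[].
clearbody m.
pose J' (o : option (hartogs T * hartogs T)) : hartogs T :=
  if o is Some (x, y) then
    rank (m x y, Some (J (Some (s (m x y) x, s (m x y) y))))
  else rank (h0, None).
exists J' => -[[x y]|] [[z w]|] //= /rankI // -[] mpq.
rewrite mpq => /JI[] /sP s1 /sP s2.
have [xm ym] := mP x y; have [zm wm] := mP z w; rewrite mpq in xm ym.
by rewrite s1 // s2.
Qed.

Lemma nat_square : exists J : option (nat * nat) -> nat, injective J.
Proof. exists choice.pickle; exact: (pcan_inj choice.pickleK). Qed.

(** * Ordinals below omega2 *)

Definition Ord_ind := well_founded_induction_type Ord_wf.

Lemma omega1_square : exists J : option (omega1 * omega1) -> omega1, injective J.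
Proof. by have [J JI] := nat_square; exact: hartogs_square JI. Qed.

(** Regularity of omega2. *)
Lemma ord_bound (a : Ord) (g : Ord -> Ord) : exists b, forall x, x < a -> g x < b.
Proof.
have [J JI] := omega1_square; have [e eI] := hartogs_segment_inj (J None) a.
exact: (hartogs_strict_bound g JI eI).
Qed.

Lemma exists_gt (x : Ord) : exists y : Ord, x < y.
Proof. by have [J JI] := omega1_square; exact: hartogs_no_max JI. Qed.

Lemma leastP (S : set Ord) : S !=set0 -> S (least S) /\ forall y, S y -> least S <= y.
Proof.
move=> /hartogs_min[x Sx xmin].
by apply: (@xgetPex _ ozero [set x | S x /\ forall y, S y -> x <= y]); exists x.
Qed.

Lemma least_eq (S : set Ord) x : S x -> (forall y, S y -> x <= y) -> least S = x.
Proof.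
move=> Sx xmin; have [|Sl lmin] := @leastP S; first by exists x.
by apply/eqP; rewrite eq_le lmin // xmin.
Qed.

Lemma ozero_le (x : Ord) : ozero <= x.
Proof. exact: svalP (cid exists_ozero) x. Qed.
#[local] Hint Resolve ozero_le : core.

Lemma ozero_lt (x : Ord) : (ozero < x) = (x != ozero).
Proof. by rewrite lt_neqAle ozero_le eq_sym andbT. Qed.

Lemma lt_ozeroF (x : Ord) : (x < ozero) = false.
Proof. by rewrite ltNge ozero_le. Qed.

Lemma osuccP (x : Ord) : x < osucc x /\ forall y, x < y -> osucc x <= y.
Proof. by apply: (@leastP [set y | x < y]); exact: exists_gt. Qed.

Lemma lt_osucc (x : Ord) : x < osucc x.
Proof. by case: (osuccP x). Qed.

Lemma osucc_le (x y : Ord) : (osucc x <= y) = (x < y).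
Proof.
by apply/idP/idP => [|/(proj2 (osuccP x))//]; apply: lt_le_trans (lt_osucc x).
Qed.

Lemma lt_osuccE (x y : Ord) : (x < osucc y) = (x <= y).
Proof. by rewrite ltNge osucc_le -leNgt. Qed.

Lemma osucc_inj : injective osucc.
Proof.
move=> x y xy; apply/eqP; rewrite eq_le -!lt_osuccE -xy lt_osucc.
by rewrite xy lt_osucc.
Qed.

Lemma osucc_gt0 (x : Ord) : ozero < osucc x.
Proof. by rewrite lt_osuccE. Qed.

Variant opred_spec (x : Ord) : option Ord -> Prop :=
| OpredSucc c of x = osucc c : opred_spec x (Some c)
| OpredLim of (forall c, c < x -> osucc c < x) : opred_spec x None.

Lemma opredP x : opred_spec x (opred x).
Proof.
rewrite /opred; case: pselect => [ex|nex].
  by case: (cid ex) => c xc; constructor.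
constructor=> c cx; rewrite lt_neqAle osucc_le cx andbT.
by apply/eqP => xc; apply: nex; exists c.
Qed.

Lemma opred_succ x : opred (osucc x) = Some x.
Proof.
case: opredP => [c /osucc_inj -> //|/(_ _ (lt_osucc x))]; by rewrite ltxx.
Qed.

Lemma opred_ozero : opred ozero = None.
Proof. by case: opredP => // c c0; have := osucc_gt0 c; rewrite -c0 ltxx. Qed.

Lemma osupP (S : set Ord) : (exists b, forall y, S y -> y <= b) ->
  (forall y, S y -> y <= osup S) /\ (forall b, (forall y, S y -> y <= b) -> osup S <= b).
Proof. exact: (@leastP [set x | forall y, S y -> y <= x]). Qed.

Lemma nat_bound (g : nat -> Ord) : exists b, forall n, g n <= b.
Proof.
have [J JI] := omega1_square.
have [l lP] : exists l : nat -> omega1, injective l.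
  exists (fun n => iter n (fun x => J (Some (x, x))) (J None)).
  elim=> [|n IHn] [|m] /=; try by move/JI.
  by move=> /JI [] /IHn ->.
have [b bP] := hartogs_bound (D := setT) (e := l) g JI (fun i j _ _ => lP i j).
by exists b => n; apply: bP.
Qed.

Definition increasing (F : Ord -> Ord) := forall x y, x < y -> F x < F y.

(** Continuity at limits only, and only the half that does not follow from
    monotonicity. *)
Definition continuous (F : Ord -> Ord) := forall y z, y != ozero ->
  (forall x, x < y -> osucc x < y) -> (forall x, x < y -> F x <= z) -> F y <= z.

Lemma increasing_le F x y : increasing F -> x <= y -> F x <= F y.
Proof. by move=> Finc; rewrite le_eqVlt => /predU1P[-> //|/Finc/ltW]. Qed.

Lemma increasing_lt F x y : increasing F -> F x < F y -> x < y.
Proof. by move=> Finc; rewrite !ltNge; apply: contra; apply: increasing_le. Qed.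

Lemma increasing_ge F x : increasing F -> x <= F x.
Proof.
move=> Finc; elim/Ord_ind: x => x IHx; rewrite leNgt; apply/negP => Fx.
by have := IHx _ Fx; rewrite leNgt Finc.
Qed.

Lemma orecE z s b : orec z s b =
  if b == ozero then z else if opred b is Some c then s (orec z s c)
  else osup [set orec z s c | c in [set c | c < b]].
Proof.
rewrite {1}/orec wfrecE; last exact: Ord_wf.
case: eqP => // _; case: opredP => [c ->|_].
  by case: pselect => //; rewrite lt_osucc.
congr osup; apply/seteqP; split=> _ [c /= cb <-]; exists c => //=.
  by case: pselect.
by case: pselect.
Qed.

Lemma orec0 z s : orec z s ozero = z.
Proof. by rewrite orecE eqxx. Qed.

Lemma orecS z s x : orec z s (osucc x) = s (orec z s x).
Proof. by rewrite orecE -(negbK (_ == _)) -ozero_lt osucc_gt0 /= opred_succ. Qed.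

Lemma orec_lim z s b : b != ozero -> (forall c, c < b -> osucc c < b) ->
  (forall c, c < b -> orec z s c <= orec z s b) /\
  (forall d, (forall c, c < b -> orec z s c <= d) -> orec z s b <= d).
Proof.
move=> b0 blim; rewrite (orecE z s b) (negbTE b0).
case: opredP => [c bc|_]; first by have := blim c; rewrite bc lt_osucc ltxx => /(_ isT).
have [|ub lub] := @osupP [set orec z s c | c in [set c | c < b]].
  have [d dP] := ord_bound b (orec z s).
  by exists d => _ [c /= cb <-]; apply/ltW/dP.
split=> [c cb|d dP]; first by apply: ub; exists c.
by apply: lub => _ [c /= cb <-]; apply: dP.
Qed.

(** Addition, multiplication and exponentiation are all instances: iterating a
    function that is inflationary from [z] on gives a normal function. *)
Lemma orec_normal z s : (forall y, z <= y -> y < s y) ->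
  [/\ increasing (orec z s), continuous (orec z s) & forall x, z <= orec z s x].
Proof.
move=> sP; have F y : z <= orec z s y /\ forall x, x < y -> orec z s x < orec z s y.
  elim/Ord_ind: y => y IHy; have [->|y0] := eqVneq y ozero.
    by rewrite orec0; split=> // x; rewrite lt_ozeroF.
  case: (opredP y) => [c yc|ylim].
    have cy : c < y by rewrite yc lt_osucc.
    have [zc cP] := IHy c cy; have sc := sP _ zc.
    rewrite yc orecS; split; first exact: le_trans zc (ltW sc).
    move=> x; rewrite lt_osuccE le_eqVlt => /predU1P[-> //|/cP/lt_trans]; exact.
  have [ub lub] := orec_lim z s y0 ylim.
  have y_gt0 : ozero < y by rewrite ozero_lt.
  split; first by rewrite -{1}(orec0 z s); apply: ub.
  move=> x xy; have sxy := ylim _ xy; have [_ /(_ x (lt_osucc x)) xs] := IHy _ sxy.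
  exact: lt_le_trans xs (ub _ sxy).
split=> [x y|y c y0 ylim yP|x]; [by case: (F y) => _; apply| |by case: (F x)].
by have [_] := orec_lim z s y0 ylim; apply.
Qed.

(** [omega] is a least element of a set that has to be shown nonempty: the least
    upper bound of the iterated successors of [ozero] is a limit. *)
Lemma omegaP : is_limit omega.
Proof.
have [|//] := @leastP [set x | is_limit x].
pose g n := iter n osucc ozero; pose S := [set x | forall n, g n <= x].
have [|lS lmin] := @leastP S; first exact: nat_bound.
exists (least S); split.
  by move=> l0; have := lS 1%N; rewrite l0 /= osucc_le ltxx.
case: opredP => // c lc; have : S c; last by move/lmin; rewrite lc osucc_le ltxx.
by move=> n; rewrite -lt_osuccE -lc; apply: lt_le_trans (lt_osucc _) (lS n.+1).
Qed.

Lemma omega_gt1 : oone < omega.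
Proof.
have [/eqP o0] := omegaP; case: opredP => // olim _.
by apply: olim; rewrite ozero_lt.
Qed.

Lemma oadd_gt y x : x != ozero -> y < oadd y x.
Proof.
rewrite -ozero_lt => x0; have [inc _ _] := @orec_normal y osucc (fun y _ => lt_osucc y).
by have := inc _ _ x0; rewrite orec0.
Qed.

Lemma oadd_ge y x : x <= oadd y x.
Proof.
by have [inc _ _] := @orec_normal y osucc (fun y _ => lt_osucc y); exact: increasing_ge.
Qed.

Lemma omul_gt y : y != ozero -> y < omul y omega.
Proof.
move=> y0; have [inc _ _] := @orec_normal ozero (fun z => oadd z y) (fun z _ => oadd_gt z y0).
by apply: le_lt_trans (inc _ _ omega_gt1); rewrite orecS orec0 oadd_ge.
Qed.

Lemma oexp_normal :
  [/\ increasing (oexp omega), continuous (oexp omega) & forall x, ozero < oexp omega x].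
Proof.
have [|inc cont ge] := @orec_normal oone (fun y => omul y omega).
  move=> y y1; apply: omul_gt; rewrite -ozero_lt; apply: lt_le_trans y1.
  exact: osucc_gt0.
by split=> // x; apply: lt_le_trans (ge x); exact: osucc_gt0.
Qed.

Lemma oexp0 : oexp omega ozero = oone.
Proof. exact: orec0. Qed.

Definition unbounded (U : set Ord) := forall x, exists2 u, U u & x < u.

(** For [y] outside [U], the hypothesis says that [y] is a limit of elements of
    [U]; allowing [u = y] spares a case distinction. *)
Definition limit_closed (U : set Ord) := forall y, y != ozero ->
  (forall x, x < y -> exists u, [/\ U u, x < u & u <= y]) -> U y.

Lemma enumE U a : enum U a = least [set x | U x /\ forall c, c < a -> enum U c < x].
Proof.
rewrite {1}/enum wfrecE; last exact: Ord_wf.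
congr least; apply/seteqP; split=> x [/= Ux xP]; split=> // c ca;
  have := xP c ca; by case: pselect.
Qed.

Lemma enumP U a : unbounded U ->
  [/\ U (enum U a), forall c, c < a -> enum U c < enum U a &
      forall x, U x -> (forall c, c < a -> enum U c < x) -> enum U a <= x].
Proof.
move=> unb; have [|] := @leastP [set x | U x /\ forall c, c < a -> enum U c < x].
  have [b bP] := ord_bound a (enum U); have [u Uu bu] := unb b.
  by exists u; split=> // c /bP /lt_trans; apply.
by rewrite -enumE => -[Ue einc] emin; split=> // x Ux xP; apply: emin.
Qed.

Lemma enum_mem U a : unbounded U -> U (enum U a).
Proof. by move=> /(enumP a)[]. Qed.

Lemma enum_increasing U : unbounded U -> increasing (enum U).
Proof. by move=> unb x y; have [_ + _] := enumP y unb; apply. Qed.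

(** Membership in a set of fixed points becomes membership in [U] plus a closure
    condition; both pass to limits when [U] is closed. *)
Lemma enum_fix U y : unbounded U ->
  (y = enum U y) <-> (U y /\ forall c, c < y -> enum U c < y).
Proof.
move=> unb; split=> [yE|[Uy yP]].
  split=> [|c cy]; first by rewrite yE; exact: enum_mem.
  by rewrite yE; exact: enum_increasing.
apply/eqP; rewrite eq_le increasing_ge; last exact: enum_increasing.
by have [_ _] := enumP y unb; apply.
Qed.

Lemma closed_fix U : unbounded U -> limit_closed U -> limit_closed [set y | y = enum U y].
Proof.
move=> unb cl y y0 yP; apply/(enum_fix y unb); split.
  apply: cl => // x /yP[u [uE xu uy]]; exists u; split=> //; rewrite uE; exact: enum_mem.
move=> c /yP[u [uE cu uy]]; apply: lt_le_trans uy; rewrite [ltRHS]uE.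
exact: enum_increasing.
Qed.

Lemma range_unbounded F : increasing F -> unbounded (range F).
Proof.
move=> Finc x; exists (F (osucc x)); first by exists (osucc x).
by apply: lt_le_trans (lt_osucc x) _; exact: increasing_ge.
Qed.

(** Lets the base case [oexp omega] of [phistar] be treated as an enumeration as
    well. *)
Lemma enum_range F : increasing F -> enum (range F) = F.
Proof.
move=> Finc; apply/funext; elim/Ord_ind => a IHa; rewrite enumE; apply: least_eq.
  by split=> [|c ca]; [exists a | rewrite IHa //; exact: Finc].
move=> _ [[b _ <-] bP]; apply: increasing_le => //; rewrite leNgt; apply/negP => ba.
by have := bP b ba; rewrite IHa // ltxx.
Qed.

Lemma range_closed F : increasing F -> continuous F -> limit_closed (range F).
Proof.
move=> Finc Fcont y y0 yP.
have [|yF Fmin] := @leastP [set x | y <= F x]; first by exists y; exact: increasing_ge.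
move: (least _) yF Fmin => x /= yF Fmin; exists x => //; apply/eqP.
rewrite eq_le yF andbT.
have Flt x' : x' < x -> F x' < y.
  by move=> x'x; rewrite ltNge; apply/negP => /Fmin; rewrite leNgt x'x.
have [x0|x0] := eqVneq x ozero.
  have [|_ [[z _ <-] _]] := yP ozero; first by rewrite ozero_lt.
  by apply: le_trans; apply: increasing_le => //; rewrite x0.
case: (opredP x) => [c xc|xlim]; last by apply: Fcont => // z /Flt/ltW.
have [|_ [[z _ <-] cz]] := yP (F c); first by apply: Flt; rewrite xc lt_osucc.
by apply: le_trans; apply: increasing_le; rewrite // xc osucc_le (increasing_lt Finc).
Qed.

(** * Finitely supported assignments *)

(** Comparison at the greatest position where the assignments differ.  The
    variant [pos_lt], which ignores position [ozero], is the relation along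
    which [phistar] recurses. *)
Definition lex_lt (t s : entries) : Prop :=
  exists2 x, t x < s x & forall y, x < y -> t y = s y.

Definition pos_lt (t s : entries) : Prop :=
  exists x, [/\ ozero < x, t x < s x & forall y, x < y -> t y = s y].

Lemma fset_max (A : {fset Ord}) (P : Ord -> Prop) : (exists2 x, x \in A & P x) ->
  exists m, [/\ m \in A, P m & forall x, x \in A -> P x -> x <= m].
Proof.
suff H (l : seq Ord) : (exists2 x, x \in l & P x) ->
    exists m, [/\ m \in l, P m & forall x, x \in l -> P x -> x <= m] by exact: H.
elim: l => [[] //|z l IHl].
have [/IHl[m [ml Pm mmax]] _|nl] := pselect (exists2 x, x \in l & P x).
  have [[Pz mz]|zm] := pselect (P z /\ m <= z).
    exists z; split=> // [|x]; rewrite inE ?eqxx // => /predU1P[-> //|xl Px].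
    exact: le_trans (mmax _ xl Px) mz.
  exists m; split=> // [|x]; rewrite inE ?ml ?orbT // => /predU1P[-> Pz|xl Px].
    by rewrite leNgt; apply/negP => mz; apply: zm; split=> //; exact: ltW.
  exact: mmax.
case=> x; rewrite inE => /predU1P[-> Pz|xl Px]; last by case: nl; exists x.
exists z; split=> // [|y]; rewrite inE ?eqxx // => /predU1P[-> //|yl Py].
by case: nl; exists y.
Qed.

Lemma entries_ext (s t : entries) : (forall x, s x = t x) -> s = t.
Proof. by move/fsfunP. Qed.

Local Notation upd s x a := [fsfun s with x |-> a].

Lemma upd_upd (s : entries) x a b : upd (upd s x a) x b = upd s x b.
Proof. by apply: entries_ext => z; rewrite !fsfun_withE; case: eqP. Qed.

Lemma entries_max (s : entries) x : s x != ozero ->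
  exists m, [/\ s m != ozero, x <= m & forall y, m < y -> s y = ozero].
Proof.
move=> sx; have [|m [_ /eqP sm mmax]] := @fset_max (finsupp s) (fun x => s x <> ozero).
  by exists x; rewrite ?mem_finsupp //; exact/eqP.
exists m; split=> // [|y my]; first by apply: mmax; rewrite ?mem_finsupp //; exact/eqP.
apply/eqP; apply: contraTT my => sy; rewrite -leNgt.
by apply: mmax; rewrite ?mem_finsupp //; exact/eqP.
Qed.

Lemma lex_total (s t : entries) : [\/ s = t, lex_lt s t | lex_lt t s].
Proof.
have [/entries_ext|/existsNP[x /eqP st]] := pselect (forall x, s x = t x).
  exact: Or31.
have mem z : s z <> t z -> z \in (finsupp s `|` finsupp t)%fset.
  rewrite inE !mem_finsupp; case: eqVneq => //= ->; case: eqVneq => // ->; exact.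
have [|m [_ /eqP stm mmax]] :=
    @fset_max (finsupp s `|` finsupp t)%fset (fun x => s x <> t x).
  by exists x; [apply: mem|]; exact/eqP.
have above y : m < y -> s y = t y.
  move=> my; apply: contrapT => sty; have := mmax y (mem _ sty) sty.
  by rewrite leNgt my.
move: stm; rewrite neq_lt => /orP[stm|tsm].
  by apply: Or32; exists m.
by apply: Or33; exists m => // y /above.
Qed.

(** Induction on a bound [p] for the support: an assignment with top position
    [m < p] is handled by induction on its entry at [m], then on the rest, which
    is supported below [m]. *)
Lemma lex_wf : well_founded lex_lt.
Proof.
suff H p (s : entries) : (forall y, p <= y -> s y = ozero) -> Acc lex_lt s.
  move=> s; have [[x sx]|/forallNP s0] := pselect (exists x, s x != ozero).
    have [m [_ _ ms]] := entries_max sx.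
    by apply: (H (osucc m)) => y; rewrite osucc_le; exact: ms.
  by apply: (H ozero) => y _; apply/eqP/negPn/negP.
elim/Ord_ind: p s => p IHp s sp.
have top m a (r : entries) : m < p -> (forall y, m <= y -> r y = ozero) ->
    Acc lex_lt (upd r m a).
  move=> mp; elim/Ord_ind: a r => a IHa r rm.
  have acc_r := IHp m mp r rm; elim: acc_r rm => {}r _ IHr rm.
  split=> t [x tx tabove].
  have t_above y : m < y -> t y = ozero.
    move=> my; have rmy : upd r m a y = ozero.
      by rewrite fsfun_withE gt_eqF //; apply/rm/ltW.
    have [xy|yx] := ltP x y; first by rewrite tabove.
    have mx := lt_le_trans my yx.
    by move: tx; rewrite fsfun_withE gt_eqF // (rm _ (ltW mx)) lt_ozeroF.
  pose t' := upd t m ozero.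
  have t'm y : m <= y -> t' y = ozero.
    by rewrite le_eqVlt fsfun_withE => /predU1P[->|my]; rewrite ?eqxx // t_above // gt_eqF.
  have tE : t = upd t' m (t m) by rewrite upd_upd fsfun_with_id.
  (* [x] is where [t] falls below the assignment: above, below or at its top [m]. *)
  have [mx|xm|xm] := ltgtP m x.
  - by move: tx; rewrite fsfun_withE (gt_eqF mx) (rm _ (ltW mx)) lt_ozeroF.
  - have tm : t m = a by rewrite tabove // fsfun_withE eqxx.
    rewrite tE tm; apply: IHr => //; exists x.
      by move: tx; rewrite !fsfun_withE lt_eqF.
    move=> y xy; rewrite fsfun_withE; case: eqP => [->|/eqP ym]; first by rewrite rm.
    by rewrite tabove // fsfun_withE (negbTE ym).
  - rewrite tE; apply: IHa => //.
    by move: tx; rewrite -xm fsfun_withE eqxx.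
have [[x sx]|/forallNP s0] := pselect (exists x, s x != ozero); last first.
  by split=> t [x]; have /negP := s0 x; rewrite negbK => /eqP ->; rewrite lt_ozeroF.
have [m [sm _ ms]] := entries_max sx.
rewrite -(fsfun_with_id s m) -(upd_upd s m ozero); apply: top.
  by rewrite ltNge; apply: contra sm => /sp ->.
by move=> y; rewrite fsfun_withE le_eqVlt eq_sym; case: eqP => //= _ /ms.
Qed.

Lemma pos_wf : well_founded pos_lt.
Proof.
move=> s; elim: (lex_wf s) => {}s _ IHs; split=> t [x [_ tx ty]].
by apply: IHs; exists x.
Qed.

Definition pos_free (s : entries) : Prop := forall x, ozero < x -> s x = ozero.

Lemma least_posP s : ~ pos_free s ->
  [/\ ozero < least_pos s, s (least_pos s) != ozero &
      forall y, ozero < y -> y < least_pos s -> s y = ozero].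
Proof.
move=> sN; have [|[l0 /eqP ls] lmin] := @leastP [set x | ozero < x /\ s x <> ozero].
  apply: contrapT => nS; apply: sN => x x0; apply: contrapT => sx.
  by apply: nS; exists x.
split=> // y y0 yl; apply: contrapT => sy; have := lmin y (conj y0 sy).
by rewrite leNgt yl.
Qed.

Lemma least_pos_eq (s : entries) x : ozero < x -> s x != ozero ->
  (forall y, ozero < y -> y < x -> s y = ozero) -> least_pos s = x.
Proof.
move=> x0 /eqP sx sy; apply: least_eq => // y [y0 yN].
by rewrite leNgt; apply/negP => /(sy _ y0).
Qed.

Lemma entries_setE s x a y z : entries_set s x a y z =
  if z == x then y else if z < least_pos s then ozero
  else if z == least_pos s then a else s z.
Proof.
rewrite /entries_set fsfunE !inE; case: eqVneq => //= _.
case: (eqVneq z (least_pos s)) => //= zl; rewrite mem_finsupp.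
by case: eqVneq => //= ->; case: ifP.
Qed.

(** * The sets enumerated by [phistar] *)

(** The set whose [s ozero]-th element is [phistar s], with the base case
    included. *)
Definition values (s : entries) : set Ord :=
  if pselect (pos_free s) then range (oexp omega)
  else [set y | forall x a, x < least_pos s -> a < s (least_pos s) ->
                y = phistar (entries_set s x a y)].

Lemma values_pos_free s : pos_free s -> values s = range (oexp omega).
Proof. by rewrite /values; case: pselect. Qed.

Lemma valuesE s : ~ pos_free s -> values s =
  [set y | forall x a, x < least_pos s -> a < s (least_pos s) ->
                y = phistar (entries_set s x a y)].
Proof. by rewrite /values; case: pselect. Qed.

Lemma pos_lt_set s x a y : ~ pos_free s -> x < least_pos s -> a < s (least_pos s) ->
  pos_lt (entries_set s x a y) s.
Proof.
move=> sN xl al; have [l0 _ _] := least_posP sN; exists (least_pos s); split=> //.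
  by rewrite entries_setE (gt_eqF xl) ltxx eqxx.
move=> z lz; rewrite entries_setE (gt_eqF (lt_trans xl lz)) (gt_eqF lz).
by rewrite ltNge (ltW lz).
Qed.

Lemma pos_freeE s : pos_free s <-> (finsupp s `<=` [fset ozero])%fset.
Proof.
split=> [s0|/fsubsetP s0 x x0].
  apply/fsubsetP => x; rewrite mem_finsupp inE; apply: contraNT => xN.
  by rewrite s0 ?ozero_lt.
apply/eqP; apply: contraTT x0; rewrite ozero_lt negbK.
by rewrite -(mem_finsupp s) => /s0; rewrite inE.
Qed.

Lemma phistarE s : phistar s = enum (values s) (s ozero).
Proof.
rewrite /phistar wfrecE; last exact: pos_wf.
have [s0|sN] := pselect (pos_free s).
  rewrite values_pos_free // enum_range; last by case: oexp_normal.
  by move/pos_freeE: s0 => ->.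
rewrite valuesE //; case: ifP => [/pos_freeE //|_]; congr enum.
apply/seteqP; split=> y /= yP x a xl al; have := yP x a xl al; case: pselect => //.
  by case; exact: pos_lt_set.
by move=> + _; case; exact: pos_lt_set.
Qed.

Lemma least_pos_ext (s t : entries) : (forall x, ozero < x -> s x = t x) -> least_pos s = least_pos t.
Proof.
move=> st; rewrite /least_pos; congr least; apply/seteqP.
by split=> x [x0 /= sx]; split=> //; [rewrite -st|rewrite st].
Qed.

Lemma values_ext (s t : entries) : (forall x, ozero < x -> s x = t x) -> values s = values t.
Proof.
move=> st; have [s0|sN] := pselect (pos_free s).
  by rewrite !values_pos_free // => x x0; rewrite -st // s0.
have tN : ~ pos_free t by move=> t0; apply: sN => x x0; rewrite st // t0.
have [l0 _ _] := least_posP sN.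
have lst := least_pos_ext st.
have est x a y : entries_set s x a y = entries_set t x a y.
  apply: entries_ext => z; rewrite !entries_setE -lst.
  case: (z == x) => //; case: ltP => // lz; case: (z == _) => //.
  by apply: st; exact: lt_le_trans l0 lz.
rewrite !valuesE //; apply/seteqP.
by split=> y /= yP x a; have := yP x a; rewrite -lst -st // est.
Qed.

Definition positive_club (U : set Ord) := [/\ limit_closed U, unbounded U & forall y, U y -> ozero < y].

(** Iterate omega times a bound of all [G d c] on the segment reached so far, and
    take the supremum. *)
Lemma closure_point (G : Ord -> Ord -> Ord -> Ord) (b a xi : Ord) :
  exists y, [/\ xi < y, forall x, x < y -> osucc x < y &
    forall d c x, d < b -> c < a -> x < y -> G d c x < y].
Proof.
have step x : exists z, x < z /\
    forall d c x', d < b -> c < a -> x' <= x -> G d c x' < z.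
  have A d c : exists z, forall x', x' < osucc x -> G d c x' < z by exact: ord_bound.
  pose A' d c := sval (cid (A d c)).
  have B d : exists z, forall c, c < a -> A' d c < z by exact: ord_bound.
  pose B' d := sval (cid (B d)).
  (* One bound per variable of [G]: [A'] over [x'], [B'] over [c], [z] over [d]. *)
  have [z zP] := ord_bound b B'.
  exists (Order.max z (osucc x)); split.
    by rewrite lt_max lt_osucc orbT.
  move=> d c x' db ca x'x; rewrite lt_max; apply/orP; left.
  apply: lt_trans (zP d db); apply: (@lt_trans _ _ (A' d c)).
    by rewrite /A'; case: cid => w /=; apply; rewrite lt_osuccE.
  by rewrite /B'; case: cid => w /=; apply.
pose next x := sval (cid (step x)).
have nextP x : x < next x /\ forall d c x', d < b -> c < a -> x' <= x -> G d c x' < next x.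
  by rewrite /next; case: cid.
clearbody next.
pose g n := iter n next (osucc xi); pose S := [set y | forall n, g n <= y].
have [yS ymin] := leastP (nat_bound g : S !=set0).
move: (least S) yS ymin => y yS ymin.
have below x : x < y -> exists n, x < g n.
  move=> xy; apply: contrapT => /forallNP nx.
  have /ymin : S x by move=> n; rewrite leNgt; apply/negP; exact: nx.
  by rewrite leNgt xy.
exists y; split.
- by apply: lt_le_trans (yS 0); exact: lt_osucc.
- move=> x /below[n xg]; apply: lt_le_trans (yS n.+1).
  by have [+ _] := nextP (g n); apply: le_lt_trans; rewrite osucc_le.
- move=> d c x db ca /below[n xg]; apply: lt_le_trans (yS n.+1).
  by have [_] := nextP (g n); apply=> //; exact: ltW.
Qed.

(** The induction step for [values_club]: [IH] covers every assignment of the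
    form [entries_set s d a y] with [d] below the least positive position and [a]
    below the entry there. *)
Section ValuesStep.
Variable s : entries.
Hypothesis sN : ~ pos_free s.
Hypothesis IH : forall t, pos_lt t s -> positive_club (values t).
Local Notation b := (least_pos s).

Lemma least_pos_set d a y : ozero < d -> d < b -> y != ozero ->
  least_pos (entries_set s d a y) = d.
Proof.
move=> d0 db y0; apply: least_pos_eq => //; first by rewrite entries_setE eqxx.
by move=> z z0 zd; rewrite entries_setE (lt_eqF zd) (lt_trans zd db).
Qed.

Lemma phistar_set_gt0 d a y : d < b -> a < s b -> ozero < phistar (entries_set s d a y).
Proof.
move=> db ab; have [_ unb pos] := IH (pos_lt_set y sN db ab).
by rewrite phistarE; apply: pos; exact: enum_mem.
Qed.

Lemma phistar_set0 a y : a < s b ->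
  phistar (entries_set s ozero a y) = enum (values (entries_set s ozero a ozero)) y.
Proof.
move=> ab; rewrite phistarE entries_setE eqxx.
suff -> : values (entries_set s ozero a y) = values (entries_set s ozero a ozero) by [].
by apply: values_ext => x x0; rewrite !entries_setE (gt_eqF x0).
Qed.

Lemma phistar_set_pos d a y : ozero < d -> d < b ->
  phistar (entries_set s d a y) = enum (values (entries_set s d a y)) ozero.
Proof.
by move=> d0 db; rewrite phistarE entries_setE (lt_eqF d0) (lt_trans d0 db).
Qed.

Lemma values_setE d a y : ozero < d -> d < b -> y != ozero ->
  values (entries_set s d a y) =
  [set w | forall x c, x < d -> c < y -> w = phistar (entries_set (entries_set s d a y) x c w)].
Proof.
move=> d0 db y0.
have ld := least_pos_set a d0 db y0.
rewrite valuesE; first by rewrite ld entries_setE eqxx.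
by move=> /(_ d d0); rewrite entries_setE eqxx; apply/eqP.
Qed.

(** Modifying an already modified assignment at [d], its new least positive
    position: the entry [y] there is overwritten, so the result depends on [y]
    only through its being nonzero. *)
Lemma set_setE d a y x c w : ozero < d -> d < b -> y != ozero ->
  entries_set (entries_set s d a y) x c w =
  [fsfun (entries_set s d a c) with x |-> w].
Proof.
move=> d0 db y0; apply: entries_ext => z.
have ld := least_pos_set a d0 db y0.
rewrite fsfun_withE entries_setE ld; case: (z == x) => //.
rewrite !entries_setE; case: ltgtP => [zd|//|//].
by rewrite (lt_trans zd db).
Qed.

(** Raising the entry at [d] from [c] to [y] imposes in particular the equation
    that has [c] at [d] and the value itself at [ozero], so the new value lies
    beyond the least value for [c]. *)
Lemma phistar_set_increasing d a : ozero < d -> d < b -> a < s b ->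
  increasing (fun y => phistar (entries_set s d a y)).
Proof.
move=> d0 db ab c y cy; have y0 : y != ozero by rewrite -ozero_lt (le_lt_trans _ cy).
have w0 := phistar_set_gt0 y db ab.
have [_ unb _] := IH (pos_lt_set y sN db ab).
have := enum_mem ozero unb; rewrite -(phistar_set_pos a y d0 db).
(* The equation of [w] with entry [c] at [d] and [w] itself at [ozero]. *)
move: (phistar (entries_set s d a y)) w0 => w w0.
rewrite values_setE // => /(_ ozero c d0 cy) ->; rewrite set_setE //.
rewrite phistar_set_pos // phistarE fsfun_withE eqxx.
have -> : values [fsfun entries_set s d a c with ozero |-> w] = values (entries_set s d a c).
  by apply: values_ext => x x0; rewrite fsfun_withE (gt_eqF x0).
have [_ unb' _] := IH (pos_lt_set c sN db ab); exact: (enum_increasing unb' w0).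
Qed.

(** Reduces a fixed point in a positive position to a membership: an element
    [y] of [values (entries_set s d a y)] is its least element, as the least
    element is at least [y] by monotonicity. *)
Lemma phistar_set_fix d a y : ozero < d -> d < b -> a < s b -> y != ozero ->
  y = phistar (entries_set s d a y) <-> values (entries_set s d a y) y.
Proof.
move=> d0 db ab y0; have [_ unb _] := IH (pos_lt_set y sN db ab).
split=> [yE|yV].
  by rewrite {2}yE phistar_set_pos //; exact: enum_mem.
apply/eqP; rewrite eq_le (increasing_ge y (phistar_set_increasing d0 db ab)).
rewrite phistar_set_pos //; have [_ _] := enumP ozero unb; apply=> // c.
by rewrite lt_ozeroF.
Qed.

Lemma values_set_antitone d a c y : ozero < d -> d < b -> a < s b -> c != ozero -> c <= y ->
  values (entries_set s d a y) `<=` values (entries_set s d a c).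
Proof.
move=> d0 db ab c0 cy; have y0 : y != ozero.
  by rewrite -ozero_lt (lt_le_trans _ cy) // ozero_lt.
rewrite !values_setE // => w /= wP x e xd ec.
rewrite (wP x e xd (lt_le_trans ec cy)) -wP //; last exact: lt_le_trans cy.
by rewrite set_setE // -(set_setE a x e w d0 db y0) -wP // (lt_le_trans ec).
Qed.

(** The entry [y] at [d] imposes exactly the equations that the entries
    [osucc c] impose for [c < y], and the sets for those entries are closed by
    induction; this is how fixed points at [d] are obtained as limits. *)
Lemma phistar_set_fix_lim d a y : ozero < d -> d < b -> a < s b -> y != ozero ->
  (forall c, c < y -> values (entries_set s d a (osucc c)) y) ->
  y = phistar (entries_set s d a y).
Proof.
move=> d0 db ab y0 yP; apply/phistar_set_fix => //; rewrite values_setE // => x c xd cy.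
have c0 : osucc c != ozero by rewrite -ozero_lt osucc_gt0.
have := yP c cy; rewrite (values_setE a d0 db c0) => /(_ x c xd (lt_osucc c)).
by rewrite !set_setE.
Qed.

Lemma values_closed : limit_closed (values s).
Proof.
move=> y y0; rewrite (valuesE sN) => yP d a db ab.
have := ozero_le d; rewrite le_eqVlt => /predU1P[d0|d0].
  subst d; rewrite phistar_set0 //.
  have [cl unb _] := IH (pos_lt_set ozero sN db ab).
  apply: (closed_fix unb cl) => // x /yP[u [uV xu uy]]; exists u; split=> //=.
  by rewrite -phistar_set0 //; exact: uV.
apply: phistar_set_fix_lim => // c cy.
have [cl _ _] := IH (pos_lt_set (osucc c) sN db ab); apply: cl => // x xy.
have [|u [uV]] := yP (Order.max x c); first by rewrite gt_max xy.
rewrite gt_max => /andP[xu cu] uy; exists u; split=> //.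
have u0 : u != ozero by rewrite -ozero_lt (le_lt_trans _ cu).
apply: (values_set_antitone d0 db ab _ (_ : osucc c <= u)).
- by rewrite -ozero_lt osucc_gt0.
- by rewrite osucc_le.
by apply/phistar_set_fix => //; exact: uV.
Qed.

Lemma values_unbounded : unbounded (values s).
Proof.
move=> xi; have [y [xiy ysucc yG]] :=
  closure_point (fun d a x => phistar (entries_set s d a x)) b (s b) xi.
exists y => //; have y0 : y != ozero by rewrite -ozero_lt (le_lt_trans _ xiy).
rewrite (valuesE sN) => d a db ab.
have := ozero_le d; rewrite le_eqVlt => /predU1P[d0|d0].
  subst d; rewrite phistar_set0 //.
  have [cl unb _] := IH (pos_lt_set ozero sN db ab).
  have einc := enum_increasing unb.
  have elt c : c < y -> enum (values (entries_set s ozero a ozero)) c < y.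
    by move=> cy; rewrite -phistar_set0 //; exact: yG.
  apply/(enum_fix _ unb); split=> //; apply: cl => // x xy.
  exists (enum (values (entries_set s ozero a ozero)) (osucc x)); split.
  - exact: enum_mem.
  - by apply: lt_le_trans (lt_osucc x) _; exact: increasing_ge.
  - by apply/ltW/elt; exact: ysucc.
apply: phistar_set_fix_lim => // c cy.
have [cl _ _] := IH (pos_lt_set (osucc c) sN db ab); apply: cl => // x xy.
pose u := Order.max (osucc x) (osucc c).
exists (phistar (entries_set s d a u)); split.
- apply: (values_set_antitone d0 db ab _ (_ : osucc c <= u)).
  + by rewrite -ozero_lt osucc_gt0.
  + by rewrite le_max lexx orbT.
  by rewrite phistar_set_pos //; apply: enum_mem; have [] := IH (pos_lt_set u sN db ab).
- apply: lt_le_trans (increasing_ge u (phistar_set_increasing d0 db ab)).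
  by rewrite lt_max lt_osucc.
- by apply/ltW/yG => //; rewrite gt_max !ysucc.
Qed.

End ValuesStep.

(** Positivity is carried along because [ozero] is not a legitimate new entry:
    putting it at [d] would change the least positive position. *)
Lemma values_club s : positive_club (values s).
Proof.
elim: (pos_wf s) => {}s _ IH.
have [s0|sN] := pselect (pos_free s).
  rewrite values_pos_free //; have [inc cont pos] := oexp_normal; split.
  - exact: range_closed.
  - exact: range_unbounded.
  - by move=> _ [x _ <-].
split; [exact: values_closed | exact: values_unbounded |] => y.
have [l0 sl _] := least_posP sN.
rewrite valuesE // => /(_ ozero ozero l0) ->; last by rewrite ozero_lt.
by apply: phistar_set_gt0 => //; rewrite ozero_lt.
Qed.

Lemma phistar_values s : values s (phistar s).
Proof. by rewrite phistarE; apply: enum_mem; have [] := values_club s. Qed.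

Lemma phistar_gt0 s : ozero < phistar s.
Proof. by have [_ _] := values_club s; apply; exact: phistar_values. Qed.

(** * Fewer fixed-point equations suffice *)

Lemma values_of_fix (s : entries) y : y = phistar [fsfun s with ozero |-> y] -> values s y.
Proof.
move=> yE; rewrite yE -(@values_ext [fsfun s with ozero |-> y]).
  exact: phistar_values.
by move=> x x0; rewrite fsfun_withE (gt_eqF x0).
Qed.

Section Reduction.
Variable s : entries.
Hypothesis sN : ~ pos_free s.
Local Notation b := (least_pos s).

Let b_gt0 : ozero < b. Proof. by have [] := least_posP sN. Qed.
Let below (t : entries) (_ : pos_lt t s) : positive_club (values t) := values_club t.

(** Needed to use the entry [oone] in [values_lim_succ]. *)
Lemma values_gt1 y : values s y -> oone < y.
Proof.
rewrite valuesE // => yP; have [_ sb _] := least_posP sN; rewrite -ozero_lt in sb.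
have yE := yP _ _ b_gt0 sb.
have y0 : ozero < y by rewrite yE; exact: phistar_gt0.
rewrite yE (phistar_set0 _ sb).
have [_ unb pos] := values_club (entries_set s ozero ozero ozero).
apply: le_lt_trans (enum_increasing unb y0); rewrite osucc_le.
by apply: pos; exact: enum_mem.
Qed.

(** A fixed point [y] is a value for the entry [c] at [b], hence satisfies every
    equation that lowers this entry further. *)
Lemma fix_drop c y : c != ozero -> y = phistar (entries_set s ozero c y) ->
  forall d a, d < b -> a < c -> y = phistar (entries_set s d a y).
Proof.
move=> c0 yE d a db ac.
have tb : entries_set s ozero c y b = c by rewrite entries_setE (gt_eqF b_gt0) ltxx eqxx.
have tN : ~ pos_free (entries_set s ozero c y).
  by move=> /(_ b b_gt0); rewrite tb; apply/eqP.
have lt : least_pos (entries_set s ozero c y) = b.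
  apply: least_pos_eq => //; first by rewrite tb.
  by move=> z z0 zb; rewrite entries_setE (gt_eqF z0) zb.
have : values (entries_set s ozero c y) y by rewrite {2}yE; exact: phistar_values.
rewrite valuesE // lt tb => /(_ d a db ac) {1}->; congr phistar.
apply: entries_ext => z; rewrite !entries_setE lt.
case: (z == d) => //; case: ltgtP => // bz.
by rewrite (gt_eqF (lt_trans b_gt0 bz)).
Qed.

Lemma set_set_ozero x a y d w : ozero < x -> x < b -> y != ozero -> d < x ->
  entries_set (entries_set s x a y) d ozero w = entries_set s d a w.
Proof.
move=> x0 xb y0 dx; rewrite set_setE //; apply: entries_ext => z.
rewrite fsfun_withE !entries_setE; case: (z == d) => //.
by case: eqVneq => // ->; rewrite xb.
Qed.

(** The equation at position [h] makes [y] a value for the entry [y] at [h]; as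
    [ozero < y], that entry may be lowered to [ozero] with [y] moved to any
    [d < h].  Lower entries at [b] follow by [fix_drop]. *)
Lemma values_succ_succ h c : b = osucc h -> s b = osucc c ->
  values s = [set y | y = phistar (entries_set s h c y)].
Proof.
move=> bh sb; rewrite valuesE //; apply/seteqP; split=> y /= yP.
  by apply: yP; [rewrite bh | rewrite sb]; exact: lt_osucc.
have hb : h < b by rewrite bh lt_osucc.
have cs : c < s b by rewrite sb lt_osucc.
have y0 : ozero < y by rewrite yP; exact: phistar_gt0.
have yc d : d < b -> y = phistar (entries_set s d c y).
  rewrite bh lt_osuccE le_eqVlt => /predU1P[-> //|dh].
  have h0 : ozero < h by apply: le_lt_trans dh.
  have /(phistar_set_fix sN below h0 hb cs) := yP; rewrite -ozero_lt y0 => /(_ isT).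
  rewrite values_setE -?ozero_lt // => /(_ d ozero dh y0).
  by rewrite set_set_ozero -?ozero_lt.
move=> d a db; rewrite sb lt_osuccE le_eqVlt => /predU1P[->|ac]; first exact: yc.
apply: (fix_drop _ (yc _ b_gt0)) => //.
by rewrite -ozero_lt (le_lt_trans _ ac).
Qed.

(** For [d < b], the equation with [oone] at [x := osucc d] yields the one with
    [y] at [d]: lower [oone] to [ozero].  Conversely a fixed point at [x] is a
    value for the entry [y] at [x], and [oone < y]. *)
Lemma values_lim_succ c : (forall x, x < b -> osucc x < b) -> s b = osucc c ->
  values s = [set y | forall x, ozero < x -> x < b ->
    y = phistar [fsfun entries_set s x c oone with ozero |-> y]].
Proof.
move=> blim sb; have cs : c < s b by rewrite sb lt_osucc.
apply/seteqP; split=> y /= yP.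
  move=> x x0 xb; have y1 := values_gt1 yP.
  have y0 : ozero < y by apply: le_lt_trans y1.
  move: yP; rewrite valuesE // => /(_ x c xb cs).
  move/(phistar_set_fix sN below x0 xb cs); rewrite -ozero_lt y0 => /(_ isT).
  rewrite values_setE -?ozero_lt // => /(_ ozero oone x0 y1).
  by rewrite set_setE -?ozero_lt.
have one0 : oone != ozero by rewrite -ozero_lt osucc_gt0.
have yc d : d < b -> y = phistar (entries_set s d c y).
  move=> db; have x0 := osucc_gt0 d; have xb := blim d db.
  have := values_of_fix (yP _ x0 xb).
  rewrite values_setE // => /(_ d ozero (lt_osucc d) (osucc_gt0 ozero)).
  by rewrite set_set_ozero // lt_osucc.
rewrite valuesE // => d a db; rewrite sb lt_osuccE le_eqVlt => /predU1P[->|ac]; first exact: yc.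
apply: (fix_drop _ (yc _ b_gt0)) => //.
by rewrite -ozero_lt (le_lt_trans _ ac).
Qed.

(** For [a < s b] the equation at [osucc a] and [fix_drop] give all the equations
    at [a]. *)
Lemma values_lim : (forall a, a < s b -> osucc a < s b) ->
  values s = [set y | forall x, ozero < x -> x < s b -> y = phistar (entries_set s ozero x y)].
Proof.
move=> slim; apply/seteqP; split=> y /= yP.
  by move=> x _ xs; move: yP; rewrite valuesE //; apply.
rewrite valuesE // => d a db ab.
have a0 := osucc_gt0 a.
apply: (fix_drop _ (yP _ a0 (slim a ab))) => //; last exact: lt_osucc.
by rewrite -ozero_lt.
Qed.

End Reduction.

(** * The order on arrays *)

Lemma elts_inj : injective elts.
Proof. exact: can_inj rel_of_elts. Qed.

Lemma elts_empty : elts emptyrel = fset0.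
Proof. by apply/fsetP => p; rewrite in_elts inE. Qed.

Lemma rel_of0 : rel_of fset0 = emptyrel.
Proof. by apply: elts_inj; rewrite elts_rel_of elts_empty. Qed.

Lemma dom_nonempty X : X != emptyrel -> exists Y, Y \in dom X.
Proof.
move=> X0; have [E|[[a Y] aY]] := fset_0Vmem (elts X).
  by case/eqP: X0; apply: elts_inj; rewrite elts_empty.
by exists Y; apply/domP; exists a.
Qed.

Lemma dom_empty Y : Y \in dom emptyrel = false.
Proof. by apply/negbTE/negP => /domP[a]; rewrite elts_empty inE. Qed.

Lemma coef_elt X Y : Y \in dom X -> (coef X Y, Y) \in elts X.
Proof. by move/domP; apply: (@xgetPex _ ozero [set a | (a, Y) \in elts X]). Qed.

Lemma coef_notin X Y : Y \notin dom X -> coef X Y = ozero.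
Proof. by move=> YN; apply: xgetPN => a aY; case/negP: YN; apply/domP; exists a. Qed.

Lemma elts_remove X Y : elts (remove X Y) = (elts X `\ (coef X Y, Y))%fset.
Proof. by rewrite remove.unlock elts_rel_of. Qed.

Lemma elts_adjoin p X : elts (adjoin p X) = (p |` elts X)%fset.
Proof. by rewrite adjoin.unlock elts_rel_of. Qed.

Lemma weight_remove X Y : Y \in dom X -> (weight (remove X Y) < weight X)%N.
Proof.
move=> YX; rewrite (weightE X) (big_fsetD1 _ (coef_elt YX)) /= -elts_remove -weightE.
by rewrite -[ltnLHS]add0n ltn_add2r expn_gt0.
Qed.

Lemma last_dom_ext r r' X : (forall U V, U \in dom X -> V \in dom X -> r U V = r' U V) ->
  last_dom r X = last_dom r' X.
Proof.
move=> rr'; rewrite /last_dom; congr (xget _ _); apply/seteqP.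
by split=> Y /= [YX YP]; split=> // Z ZX; [rewrite -rr'|rewrite rr']; rewrite ?YP.
Qed.

Lemma weight_lt_wf : well_founded weight_lt.
Proof.
suff H n p : (weight p.1 + weight p.2 < n)%N -> Acc weight_lt p.
  by move=> p; exact: (H _ _ (ltnSn _)).
elim: n p => [p|n IHn p]; [by rewrite ltn0 | rewrite ltnS] => pn; split=> q qp.
by apply: IHn; exact: leq_trans qp pn.
Qed.

(** The recursive calls in [prec], with the default value off the relation. *)
Definition prec_guard (p q : hrel * hrel) : bool :=
  if pselect (weight_lt q p) then prec q.1 q.2 else false.

Lemma prec_guardE p q : weight_lt q p -> prec_guard p q = prec q.1 q.2.
Proof. by rewrite /prec_guard; case: pselect. Qed.

Lemma prec_bodyE X Y : prec X Y = prec_body (prec_guard (X, Y)) (X, Y).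
Proof.
rewrite {1}/prec wfrecE; last exact: weight_lt_wf.
by congr prec_body; apply/funext => -[U V]; rewrite /prec_guard; case: pselect.
Qed.

#[local] Opaque prec.

Lemma precX0 X : prec X emptyrel = false.
Proof. by rewrite prec_bodyE /prec_body eqxx. Qed.

Lemma prec0X X : X != emptyrel -> prec emptyrel X.
Proof. by move=> X0; rewrite prec_bodyE /prec_body (negbTE X0) eqxx. Qed.

Lemma precE X Y : arr_b X \in dom X -> arr_b Y \in dom Y -> prec X Y =
  if arr_b X != arr_b Y then prec (arr_b X) (arr_b Y)
  else if coef X (arr_b X) != coef Y (arr_b Y) then coef X (arr_b X) < coef Y (arr_b Y)
  else prec (remove X (arr_b X)) (remove Y (arr_b Y)).
Proof.
move=> bX bY; rewrite prec_bodyE /prec_body.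
have -> : (Y == emptyrel) = false by apply/eqP => E; move: bY; rewrite E dom_empty.
have -> : (X == emptyrel) = false by apply/eqP => E; move: bX; rewrite E dom_empty.
have -> : last_dom (fun U V => prec_guard (X, Y) (U, V)) X = arr_b X.
  apply: last_dom_ext => U V UX VX; rewrite prec_guardE // /weight_lt /=.
  exact: leq_trans (weight_pair UX VX) (leq_addr _ _).
have -> : last_dom (fun U V => prec_guard (X, Y) (U, V)) Y = arr_b Y.
  apply: last_dom_ext => U V UY VY; rewrite prec_guardE // /weight_lt /=.
  exact: leq_trans (weight_pair UY VY) (leq_addl _ _).
have wX := weight_dom bX; have wY := weight_dom bY.
have rX := weight_remove bX; have rY := weight_remove bY.
rewrite !prec_guardE // /weight_lt /=; last first.
  by rewrite -addnS; apply: leq_add (ltnW wX) wY.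
by rewrite -addnS; apply: leq_add (ltnW rX) rY.
Qed.

(** [arr_b] is meaningful only once [prec] is known to order the keys, whose
    weight is smaller.  Hence the order axioms are proved together, by induction
    on a bound for the weight. *)
Definition prec_order_below n :=
  [/\ forall X, (weight X < n)%N -> ~~ prec X X,
      forall X Y Z, (weight X < n)%N -> (weight Y < n)%N -> (weight Z < n)%N ->
        prec X Y -> prec Y Z -> prec X Z &
      forall X Y, (weight X < n)%N -> (weight Y < n)%N -> X != Y -> prec X Y || prec Y X].

Lemma seq_prec_max n (l : seq hrel) : prec_order_below n ->
  l != [::] -> (forall Y, Y \in l -> weight Y < n)%N ->
  exists2 Y, Y \in l & forall Z, Z \in l -> ~~ prec Y Z.
Proof.
case=> irr tr tot; elim: l => // Y [_ _ lw|Y' l IHl _ lw].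
  exists Y; rewrite ?inE // => Z; rewrite inE => /eqP ->; apply: irr; apply: lw.
  by rewrite inE.
have [//|U Ul|M Ml Mmax] := IHl; first by apply: lw; rewrite inE Ul orbT.
have wY : (weight Y < n)%N by apply: lw; rewrite inE eqxx.
have wl Z : Z \in Y' :: l -> (weight Z < n)%N by move=> Zl; apply: lw; rewrite inE Zl orbT.
have [MY|MY] := boolP (prec M Y).
  exists Y => [|Z]; rewrite inE ?eqxx // => /predU1P[->|Zl]; first exact: irr.
  by apply/negP => YZ; have /negP := Mmax Z Zl; apply; apply: tr MY YZ; auto.
by exists M => [|Z]; rewrite inE ?Ml ?orbT // => /predU1P[-> //|]; exact: Mmax.
Qed.

Lemma arr_b_below n X : prec_order_below n -> (weight X <= n)%N -> X != emptyrel ->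
  arr_b X \in dom X /\ forall Z, Z \in dom X -> ~~ prec (arr_b X) Z.
Proof.
move=> ord Xn /dom_nonempty[Y YX].
have [||M Mdom Mmax] := @seq_prec_max n (dom X) ord.
- by apply/eqP => E; have : Y \in enum_fset (dom X) by []; rewrite E.
- by move=> Z ZX; apply: leq_trans (weight_dom ZX) Xn.
by apply: (@xgetPex _ emptyrel [set Y | Y \in dom X /\ forall Z, Z \in dom X -> ~~ prec Y Z]);
  exists M.
Qed.

Lemma remove_inj X Y Z : Z \in dom X -> Z \in dom Y -> coef X Z = coef Y Z ->
  remove X Z = remove Y Z -> X = Y.
Proof.
move=> ZX ZY cXY rXY; apply: elts_inj.
rewrite -(fsetD1K (coef_elt ZX)) -(fsetD1K (coef_elt ZY)) -!elts_remove.
by rewrite rXY cXY.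
Qed.

(** [prec] compares the triples of greatest key, its coefficient, and the array
    without that entry, lexicographically; the three orders involved are strict
    and total by induction, and the triple determines the array. *)
Lemma prec_orderS n : prec_order_below n -> prec_order_below n.+1.
Proof.
move=> ord; have [irr tr tot] := ord.
have bP X : (weight X < n.+1)%N -> X != emptyrel ->
    [/\ arr_b X \in dom X, (weight (arr_b X) < n)%N & (weight (remove X (arr_b X)) < n)%N].
  move=> Xn X0; have [bX _] := arr_b_below ord Xn X0; split=> //.
    by apply: leq_trans (weight_dom bX) Xn.
  by apply: leq_trans (weight_remove bX) Xn.
have neq0 X Y : prec X Y -> Y != emptyrel by apply: contraTneq => ->; rewrite precX0.
split.
- move=> X Xn; have [->|X0] := eqVneq X emptyrel; first by rewrite precX0.
  by have [bX _ rX] := bP _ Xn X0; rewrite (precE bX bX) !eqxx; exact: irr.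
- move=> X Y Z Xn Yn Zn XY YZ; have Z0 := neq0 _ _ YZ; have Y0 := neq0 _ _ XY.
  have [->|X0] := eqVneq X emptyrel; first exact: prec0X.
  have [bX wX rX] := bP _ Xn X0; have [bY wY rY] := bP _ Yn Y0.
  have [bZ wZ rZ] := bP _ Zn Z0; move: XY YZ.
  rewrite (precE bX bY) (precE bY bZ) (precE bX bZ).
  have [eXY|nXY] := eqVneq (arr_b X) (arr_b Y); last first.
    move=> /= XY; have [eYZ|nYZ] /= := eqVneq (arr_b Y) (arr_b Z).
      by move=> _; rewrite -eYZ nXY.
    move=> YZ; have XZ := tr _ _ _ wX wY wZ XY YZ.
    suff -> : arr_b X != arr_b Z by [].
    by apply/eqP => E; move: XZ; rewrite E => XZ; have := irr _ wZ; rewrite XZ.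
  rewrite eXY /= => cXY; have [eYZ|nYZ] //= := eqVneq (arr_b Y) (arr_b Z).
  rewrite -eYZ; move: cXY.
  have [-> /= rXY|cXY /= lXY] := eqVneq (coef X _) (coef Y _).
    have [-> /=|//] := eqVneq (coef Y _) (coef Z _).
    by move: rX rY rZ; rewrite -eYZ eXY => rX rY rZ; apply: tr rXY.
  have [<- _|_ /= lYZ] := eqVneq (coef Y _) (coef Z _); first by rewrite cXY.
  by rewrite (lt_eqF (lt_trans lXY lYZ)) /= (lt_trans lXY lYZ).
- move=> X Y Xn Yn XY; have [X0|X0] := eqVneq X emptyrel.
    by rewrite X0 prec0X // -X0 eq_sym.
  have [Y0|Y0] := eqVneq Y emptyrel; first by rewrite Y0 (prec0X X0) orbT.
  have [bX wX rX] := bP _ Xn X0; have [bY wY rY] := bP _ Yn Y0.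
  rewrite (precE bX bY) (precE bY bX); have [eXY|nXY] := eqVneq (arr_b X) (arr_b Y); last exact: tot.
  rewrite eXY /=.
  have [cXY|cXY] := eqVneq (coef X _) (coef Y _); last by rewrite -neq_lt.
  move: rX rY bX; rewrite eXY => rX rY bX; apply: tot => //.
  by apply: contraNneq XY => /(remove_inj bX bY cXY) ->.
Qed.

Lemma prec_order n : prec_order_below n.
Proof. by elim: n => [|n]; [split | exact: prec_orderS]. Qed.

Lemma prec_irr X : prec X X = false.
Proof. by have [irr _ _] := prec_order (weight X).+1; apply/negbTE/irr. Qed.

Lemma prec_trans X Y Z : prec X Y -> prec Y Z -> prec X Z.
Proof.
have [_ tr _] := prec_order (weight X + weight Y + weight Z).+1.
by apply: tr; rewrite ltnS; lia.
Qed.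

Lemma prec_total X Y : X != Y -> prec X Y || prec Y X.
Proof.
have [_ _ tot] := prec_order (weight X + weight Y).+1.
by apply: tot; rewrite ltnS; lia.
Qed.

Lemma arr_bP X : X != emptyrel ->
  arr_b X \in dom X /\ forall Z, Z \in dom X -> ~~ prec (arr_b X) Z.
Proof. exact: arr_b_below (prec_order _) (leqnn _). Qed.

Lemma arr_b_eq X Y : Y \in dom X -> (forall Z, Z \in dom X -> Z != Y -> prec Z Y) ->
  arr_b X = Y.
Proof.
move=> YX Ymax; have X0 : X != emptyrel by apply: contraTneq YX => ->; rewrite dom_empty.
have [bX bmax] := arr_bP X0; apply/eqP/negPn/negP => /(Ymax _ bX).
by apply/negP; exact: bmax.
Qed.

Lemma arr_bbar_eq X Y : Y \in dom X -> (forall Z, Z \in dom X -> Z != Y -> prec Y Z) ->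
  arr_bbar X = Y.
Proof.
move=> YX Ymin; rewrite /arr_bbar /first_dom; apply: xget_unique.
  split=> // Z ZX; have [->|/(Ymin _ ZX) YZ] := eqVneq Z Y; first by rewrite prec_irr.
  by apply/negP => /(prec_trans YZ); rewrite prec_irr.
move=> Z /= [ZX Zmin]; apply/eqP/negPn/negP => /(Ymin _ ZX).
by apply/negP; exact: Zmin.
Qed.

(** * Assignments as arrays *)

Definition key (x : Ord) : hrel := if x == ozero then emptyrel else underline x.

Definition array_of (s : entries) : hrel :=
  rel_of [fset (s x, key x) | x in finsupp s]%fset.

Lemma key0 : key ozero = emptyrel.
Proof. by rewrite /key eqxx. Qed.

Lemma elts_underline x : elts (underline x) = [fset (x, emptyrel)]%fset.
Proof. by rewrite /underline elts_rel_of. Qed.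

Lemma key_eq0 x : (key x == emptyrel) = (x == ozero).
Proof.
rewrite /key; case: (eqVneq x ozero) => [_|x0]; first by rewrite eqxx.
by apply/eqP => /(congr1 elts) /fsetP/(_ (x, emptyrel));
  rewrite elts_underline elts_empty !inE eqxx.
Qed.

Lemma key_inj : injective key.
Proof.
move=> x y; have [->|x0] := eqVneq x ozero.
  by rewrite key0 => /esym/eqP; rewrite key_eq0 => /eqP.
have [->|y0] := eqVneq y ozero.
  by rewrite key0 => /eqP; rewrite key_eq0 (negbTE x0).
rewrite /key (negbTE x0) (negbTE y0) => /(congr1 elts)/fsetP/(_ (x, emptyrel)).
by rewrite !elts_underline !inE eqxx => /esym/eqP[].
Qed.

Lemma elts_arrP (s : entries) a Y :
  (a, Y) \in elts (array_of s) <-> exists x, [/\ s x != ozero, a = s x & Y = key x].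
Proof.
rewrite /array_of elts_rel_of; split=> [/imfsetP[x /= xs [-> ->]]|[x [xs -> ->]]].
  by exists x; split=> //; rewrite -mem_finsupp.
by apply/imfsetP; exists x; rewrite //= mem_finsupp.
Qed.

Lemma arr_eq X (s : entries) :
  (forall a Y, (a, Y) \in elts X -> exists x, [/\ s x != ozero, a = s x & Y = key x]) ->
  (forall x, s x != ozero -> (s x, key x) \in elts X) -> X = array_of s.
Proof.
move=> Xs sX; apply: elts_inj; apply/fsetP => -[a Y]; apply/idP/idP.
  by move=> /Xs ?; apply/elts_arrP.
by move=> /elts_arrP[x [sx -> ->]]; apply: sX.
Qed.

Lemma dom_arr (s : entries) Y :
  Y \in dom (array_of s) <-> exists2 x, s x != ozero & Y = key x.
Proof.
split=> [/domP[a /elts_arrP[x [sx _ ->]]]|[x sx ->]]; first by exists x.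
by apply/domP; exists (s x); apply/elts_arrP; exists x.
Qed.

Lemma dom_arr_key (s : entries) x : (key x \in dom (array_of s)) = (s x != ozero).
Proof.
by apply/idP/idP => [/dom_arr[y sy /key_inj ->] //|sx]; apply/dom_arr; exists x.
Qed.

(** Holds off the support too, as [ozero] is the default value of both sides. *)
Lemma coef_arr (s : entries) x : coef (array_of s) (key x) = s x.
Proof.
have [sx|sx] := eqVneq (s x) ozero.
  by rewrite coef_notin ?sx // dom_arr_key sx eqxx.
have : key x \in dom (array_of s) by rewrite dom_arr_key.
by move=> /coef_elt/elts_arrP[y [_ -> /key_inj ->]].
Qed.

Lemma arr_empty (s : entries) : (array_of s == emptyrel) <-> (forall x, s x = ozero).
Proof.
split=> [/eqP E x|s0].
  apply/eqP; rewrite -[_ == _]negbK -dom_arr_key E; apply/negP => /domP[a].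
  by rewrite elts_empty inE.
by apply/negPn/negP => /dom_nonempty[Y] /dom_arr[x]; rewrite s0 eqxx.
Qed.

Lemma remove_arr (s : entries) x :
  remove (array_of s) (key x) = array_of [fsfun s with x |-> ozero].
Proof.
apply: arr_eq => [a Y|y].
  rewrite elts_remove inE coef_arr inE => /andP[aY /elts_arrP[y [sy ay Yy]]].
  exists y; rewrite fsfun_withE; case: (eqVneq y x) => yx //.
  by rewrite ay Yy yx eqxx in aY.
rewrite fsfun_withE; case: (eqVneq y x) => [_|yx sy]; first by rewrite eqxx.
rewrite elts_remove inE coef_arr inE; apply/andP; split; last by apply/elts_arrP; exists y.
by apply: contraNneq yx => -[_ /key_inj ->].
Qed.

Lemma below_dom_wf : well_founded below_dom.
Proof.
suff H n X : (weight X < n)%N -> Acc below_dom X by move=> X; exact: (H _ _ (ltnSn _)).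
elim: n X => [X|n IHn X]; [by rewrite ltn0 | rewrite ltnS => Xn; split=> Y /weight_dom YX].
by apply: IHn; exact: leq_trans YX Xn.
Qed.

Lemma arr_dE X :
  arr_d X = rel_of [fset (p.1, arr_d p.2) | p in [fset p in elts X | ozero < p.1]]%fset.
Proof.
rewrite {1}/arr_d wfrecE; last exact: below_dom_wf.
congr rel_of; apply/fsetP => q; apply/imfsetP/imfsetP => -[p /= pX ->]; exists p => //;
  case: pselect => // pN; case: pN; apply/domP; exists p.1;
  by move: pX; rewrite !inE -surjective_pairing => /andP[].
Qed.

Lemma arr_d_empty : arr_d emptyrel = emptyrel.
Proof.
rewrite arr_dE; rewrite -[RHS]rel_of0; congr rel_of; apply/fsetP => q; rewrite [RHS]inE.
by apply/negbTE/negP => /imfsetP[p /=]; rewrite !inE elts_empty inE.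
Qed.

Lemma arr_d_underline x : arr_d (underline x) = key x.
Proof.
rewrite arr_dE /key; case: eqVneq => [->|x0].
  rewrite -[RHS]rel_of0; congr rel_of; apply/fsetP => q; rewrite [RHS]inE.
  by apply/negbTE/negP => /imfsetP[p /=]; rewrite !inE elts_underline inE =>
    /andP[/eqP -> /=]; rewrite ltxx.
rewrite /underline; congr rel_of; apply/fsetP => q.
apply/imfsetP/fset1P => [[p /=]|->].
  by rewrite !inE elts_underline inE => /andP[/eqP -> _ ->]; rewrite arr_d_empty.
by exists (x, emptyrel); rewrite /= ?arr_d_empty // !inE elts_underline inE eqxx ozero_lt.
Qed.

Lemma arr_d_key x : arr_d (key x) = key x.
Proof.
rewrite {1}/key; case: eqP => [->|_]; last exact: arr_d_underline.
by rewrite arr_d_empty key0.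
Qed.

Lemma arr_d_eq X (s : entries) :
  (forall a Y, (a, Y) \in elts X -> a != ozero -> exists2 x, a = s x & arr_d Y = key x) ->
  (forall x, s x != ozero -> exists2 Y, (s x, Y) \in elts X & arr_d Y = key x) ->
  arr_d X = array_of s.
Proof.
move=> Xs sX; apply: arr_eq => [a Y|x sx]; rewrite arr_dE elts_rel_of.
  move=> /imfsetP[[b Z] /=]; rewrite !inE /= => /andP[bZ b0] [-> ->].
  rewrite ozero_lt in b0; have [x bx Zx] := Xs _ _ bZ b0.
  by exists x; split=> //; rewrite -bx.
have [Y xY Yx] := sX x sx.
by apply/imfsetP; exists (s x, Y); rewrite /= ?Yx // !inE xY ozero_lt.
Qed.

Lemma arr_d_adjoin (s : entries) x a : s x = ozero ->
  arr_d (adjoin (a, key x) (array_of s)) = array_of [fsfun s with x |-> a].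
Proof.
move=> sx; apply: arr_d_eq => [b Y|y].
  rewrite elts_adjoin !inE => /orP[/eqP[-> ->] _|/elts_arrP[y [sy -> ->]] _].
    by exists x; rewrite ?arr_d_key // fsfun_withE eqxx.
  exists y; rewrite ?arr_d_key // fsfun_withE; case: eqP => // yx.
  by move: sy; rewrite yx sx eqxx.
rewrite fsfun_withE; case: (eqVneq y x) => [->|yx] sy; (eexists; last exact: arr_d_key);
  rewrite elts_adjoin !inE ?eqxx //.
by apply/orP; right; apply/elts_arrP; exists y.
Qed.

Lemma arr_d_adjoin2 (s : entries) x a y c : s x = ozero -> s y = ozero -> x != y ->
  arr_d (adjoin (a, key x) (adjoin (c, key y) (array_of s))) =
  array_of [fsfun [fsfun s with y |-> c] with x |-> a].
Proof.
move=> sx sy xy; apply: arr_d_eq => [b Y|z].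
  rewrite !elts_adjoin !inE => /or3P[/eqP[-> ->] _|/eqP[-> ->] _|/elts_arrP[z [sz -> ->]] _].
  - by exists x; rewrite ?arr_d_key // fsfun_withE eqxx.
  - by exists y; rewrite ?arr_d_key // !fsfun_withE eqxx eq_sym (negbTE xy).
  exists z; rewrite ?arr_d_key // !fsfun_withE.
  case: eqP => [zx|_]; first by move: sz; rewrite zx sx eqxx.
  by case: eqP => // zy; move: sz; rewrite zy sy eqxx.
rewrite !fsfun_withE; case: (eqVneq z x) => [->|zx]; last case: (eqVneq z y) => [->|zy];
  move=> sz; (eexists; last exact: arr_d_key); rewrite !elts_adjoin !inE ?eqxx ?orbT //.
by apply/or3P/Or33/elts_arrP; exists z.
Qed.

Lemma arr_of (X : hrel) :
  (forall a b Y, (a, Y) \in elts X -> (b, Y) \in elts X -> a = b) ->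
  (forall a Y, (a, Y) \in elts X -> a != ozero /\ exists x, Y = key x) ->
  exists s, X = array_of s.
Proof.
move=> Xinj Xkey.
(* [A] collects the positions whose keys occur in [X]. *)
pose A := [fset xget ozero [set x | Y = key x] | Y in dom X]%fset.
pose s : entries := [fsfun x in A => coef X (key x) | ozero].
have sE x : s x = coef X (key x).
  rewrite /s fsfunE; case: ifPn => // xA; rewrite coef_notin //.
  apply: contra xA => kx; apply/imfsetP; exists (key x) => //=; apply/esym.
  by apply: xget_unique => // y /key_inj.
exists s; apply: arr_eq => [a Y aY|x].
  have [a0 [x Yx]] := Xkey _ _ aY; have YX : Y \in dom X by apply/domP; exists a.
  have ca : coef X Y = a by apply: Xinj aY; exact: coef_elt.
  by exists x; rewrite sE -Yx ca.
rewrite sE => cx; apply: coef_elt; apply/negPn/negP => /coef_notin c0.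
by rewrite c0 eqxx in cx.
Qed.

Lemma arraysP X : arrays X ->
  (forall a b Y, (a, Y) \in elts X -> (b, Y) \in elts X -> a = b) /\
  (forall a Y, (a, Y) \in elts X -> a != ozero /\ arrays Y).
Proof.
case=> n _; elim: n X => [X ->|n IHn X /= [/IHn //|[_ Xinj Xs]]].
  by split=> [a b Y|a Y]; rewrite elts_empty inE.
split=> [a b Y aY bY|a Y aY]; first by have [//|] := Xinj _ _ _ _ aY bY.
by have [/eqP a0 Yn] := Xs _ _ aY; split=> //; exists n.
Qed.

Lemma stage1_key x : stage [set x | x <> ozero] 1 (key x).
Proof.
rewrite /key; case: eqP => [_|x0]; first by left.
right; split.
- by move=> /(congr1 elts)/fsetP/(_ (x, emptyrel)); rewrite elts_underline elts_empty !inE eqxx.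
- by move=> a Y b Z; rewrite elts_underline !inE => /eqP[-> _] /eqP[-> _]; left.
- by move=> a Y; rewrite elts_underline !inE => /eqP[-> ->].
Qed.

Lemma arrays_arr s : arrays (array_of s).
Proof.
exists 2%N => //; have [s0|s0] := pselect (array_of s = emptyrel); first by left; left.
right; split=> // [a Y b Z|a Y] /elts_arrP[x [sx -> ->]].
  move=> /elts_arrP[y [sy -> ->]]; have [->|xy] := eqVneq x y; first by left.
  by right=> /key_inj /eqP; rewrite (negbTE xy).
by split; [exact/eqP | exact: stage1_key].
Qed.

(** The assignment whose array is [key x], so that the general lemmas apply to
    keys. *)
Definition single (x : Ord) : entries := [fsfun [fsfun] with ozero |-> x].

Lemma singleE x y : single x y = if y == ozero then x else ozero.
Proof. by rewrite fsfun_withE fsfun0E. Qed.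

Lemma arr_single x : array_of (single x) = key x.
Proof.
apply/esym/arr_eq => [a Y|y].
  rewrite /key; case: (eqVneq x ozero) => x0; first by rewrite elts_empty inE.
  rewrite elts_underline inE => /eqP[-> ->]; exists ozero.
  by rewrite singleE eqxx.
rewrite singleE; case: (eqVneq y ozero) => [-> x0|_]; last by rewrite eqxx.
by rewrite key0 /key (negbTE x0) elts_underline inE.
Qed.

Lemma single_with x y : [fsfun single x with ozero |-> y] = single y.
Proof. by apply: entries_ext => z; rewrite fsfun_withE !singleE; case: (z == ozero). Qed.

Lemma coef_key x : coef (key x) emptyrel = x.
Proof. by rewrite -arr_single -key0 coef_arr singleE eqxx. Qed.

Lemma dom_key x Y : Y \in dom (key x) -> Y = emptyrel.
Proof.
rewrite -arr_single => /dom_arr[y]; rewrite singleE.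
by case: (eqVneq y ozero) => [-> _ ->|_]; rewrite ?key0 ?eqxx.
Qed.

Lemma empty_dom_key x : (emptyrel \in dom (key x)) = (x != ozero).
Proof. by rewrite -arr_single -key0 dom_arr_key singleE eqxx. Qed.

Lemma arr_b_key x : x != ozero -> arr_b (key x) = emptyrel.
Proof.
move=> x0; apply: arr_b_eq; first by rewrite empty_dom_key.
by move=> Z /dom_key ->; rewrite eqxx.
Qed.

Lemma arr_bbar_key x : x != ozero -> arr_bbar (key x) = emptyrel.
Proof.
move=> x0; apply: arr_bbar_eq; first by rewrite empty_dom_key.
by move=> Z /dom_key ->; rewrite eqxx.
Qed.

Lemma prec_key x y : x < y -> prec (key x) (key y).
Proof.
move=> xy; have y0 : y != ozero by rewrite -ozero_lt (le_lt_trans _ xy).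
have [->|x0] := eqVneq x ozero; first by rewrite key0 prec0X // key_eq0.
rewrite precE ?arr_b_key // ?empty_dom_key // eqxx /= !coef_key (lt_eqF xy).
exact: xy.
Qed.

(** The greatest key of a predecessor of [underline m] cannot exceed the empty
    array, which is least; so the empty array is its only key. *)
Lemma prec_keyP X m : arrays X -> prec X (key m) -> exists2 x, x < m & X = key x.
Proof.
move=> aX Xm; have m0 : m != ozero.
  by apply: contraTneq Xm => ->; rewrite key0 precX0.
have [->|X0] := eqVneq X emptyrel; first by exists ozero; rewrite ?key0 // ozero_lt.
have [bX bmax] := arr_bP X0.
have bm : arr_b (key m) \in dom (key m) by rewrite arr_b_key // empty_dom_key.
move: Xm; rewrite (precE bX bm) arr_b_key //.
have [b0|bN0] := eqVneq (arr_b X) emptyrel; last by rewrite /= precX0.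
rewrite b0 /= in bX bmax *.
have domX Z : Z \in dom X -> Z = emptyrel.
  by move=> /bmax; apply: contraNeq; exact: prec0X.
have [Xinj Xpos] := arraysP aX.
have [|s Xs] := @arr_of X Xinj.
  move=> a Y aY; have [a0 _] := Xpos _ _ aY; split=> //; exists ozero.
  by rewrite key0; apply: domX; apply/domP; exists a.
have Xk : X = key (s ozero).
  rewrite -arr_single Xs; congr array_of; apply: entries_ext => y; rewrite singleE.
  case: (eqVneq y ozero) => [-> //|y0]; apply/eqP; apply: contraNT y0 => sy.
  have : key y \in dom X by rewrite Xs dom_arr_key.
  by move=> /domX/eqP; rewrite key_eq0.
(* With equal entries, removing the empty key leaves two empty arrays. *)
rewrite Xk !coef_key; case: eqVneq => [->|_] /= lt; last by exists (s ozero).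
by move: lt; rewrite -key0 -arr_single !remove_arr single_with prec_irr.
Qed.

Lemma arr_b_arr (s : entries) m : s m != ozero -> (forall y, m < y -> s y = ozero) ->
  arr_b (array_of s) = key m.
Proof.
move=> sm ms; apply: arr_b_eq; first by rewrite dom_arr_key.
move=> Z /dom_arr[x sx ->] xm; apply: prec_key; rewrite ltNge le_eqVlt.
apply/norP; split; first by apply: contraNneq xm => ->.
by apply: contraNN sx => /ms ->.
Qed.

Lemma arr_bbar_arr (s : entries) m : s m != ozero -> (forall y, y < m -> s y = ozero) ->
  arr_bbar (array_of s) = key m.
Proof.
move=> sm ms; apply: arr_bbar_eq; first by rewrite dom_arr_key.
move=> Z /dom_arr[x sx ->] xm; apply: prec_key; rewrite ltNge le_eqVlt.
apply/norP; split; first by apply: contraNneq xm => ->.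
by apply: contraNN sx => /ms ->.
Qed.

Lemma arr_h_arr s : arr_h (array_of s) = array_of [fsfun s with ozero |-> ozero].
Proof.
rewrite /arr_h -key0 dom_arr_key remove_arr; case: eqVneq => //= s0.
by rewrite -[in LHS](fsfun_with_id s ozero) s0.
Qed.

Lemma entries_top (s : entries) x : s x != ozero ->
  exists m, [/\ s m != ozero, x <= m, forall y, m < y -> s y = ozero & arr_b (array_of s) = key m].
Proof.
by move=> /entries_max[m [sm xm ms]]; exists m; split=> //; exact: arr_b_arr.
Qed.

Lemma prec_lex s t : lex_lt s t -> prec (array_of s) (array_of t).
Proof.
elim: (lex_wf t) s => {}t _ IH s [x st above].
have tx : t x != ozero by rewrite -ozero_lt (le_lt_trans _ st).
have [m [tm xm mt bt]] := entries_top tx.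
have bdt : arr_b (array_of t) \in dom (array_of t) by rewrite bt dom_arr_key.
have t0 : array_of t != emptyrel by apply: contraNneq tx => /eqP/arr_empty ->.
have [s0|/existsNP[y /eqP sy]] := pselect (forall x, s x = ozero).
  have -> : array_of s = emptyrel by apply/eqP/arr_empty.
  exact: prec0X.
have [n [sn yn ns bs]] := entries_top sy.
have bds : arr_b (array_of s) \in dom (array_of s) by rewrite bs dom_arr_key.
rewrite (precE bds bdt) bs bt !coef_arr !remove_arr.
have [nm|mn|mn] := ltgtP n m.
- by rewrite (_ : key n != key m) ?prec_key //; apply/eqP => /key_inj E; move: nm; rewrite E ltxx.
- by move: sn; rewrite (above _ (le_lt_trans xm mn)) (mt _ mn) eqxx.
- rewrite mn eqxx /=; have [stm|stm] := eqVneq (s m) (t m); last first.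
    move: xm; rewrite le_eqVlt => /predU1P[<- //|/above E].
    by rewrite E eqxx in stm.
  apply: IH; first by exists m; rewrite ?fsfun_withE ?eqxx ?ozero_lt // => z mz;
    rewrite fsfun_withE (gt_eqF mz).
  exists x => [|z xz]; rewrite !fsfun_withE; last by case: ifP => // _; exact: above.
  by case: eqVneq => // E; move: st; rewrite E stm ltxx.
Qed.

Lemma lex_prec s t : prec (array_of s) (array_of t) -> lex_lt s t.
Proof.
move=> st; have [E|//|/prec_lex ts] := lex_total s t.
  by move: st; rewrite E prec_irr.
by have := prec_trans st ts; rewrite prec_irr.
Qed.

(** Accessibility needs all arrays below [array_of t], of whatever nesting
    depth: their greatest key is at most that of [t], so all their keys are keys
    of positions. *)
Lemma arr_below X t : arrays X -> prec (arr_h X) (array_of t) -> exists s, X = array_of s.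
Proof.
move=> aX Xt; have [Xinj Xpos] := arraysP aX; apply: arr_of => // a Y aY.
have [a0 aY'] := Xpos _ _ aY; split=> //.
have [->|Y0] := eqVneq Y emptyrel; first by exists ozero; rewrite key0.
have domh : {subset dom (arr_h X) <= dom X}.
  move=> Z; rewrite /arr_h; case: ifP => // _ /domP[b].
  by rewrite elts_remove inE => /andP[_ bZ]; apply/domP; exists b.
have Yh : Y \in dom (arr_h X).
  rewrite /arr_h; case: ifP => _; apply/domP; exists a => //.
  by rewrite elts_remove inE inE aY andbT; apply: contraNneq Y0 => -[_ ->].
have hN0 : arr_h X != emptyrel by apply: contraTneq Yh => ->; rewrite dom_empty.
have [bh bmax] := arr_bP hN0.
have tN0 : array_of t != emptyrel by apply: contraTneq Xt => ->; rewrite precX0.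
have [bt _] := arr_bP tN0; have [m tm bm] := (dom_arr _ _).1 bt.
have aZ Z : Z \in dom X -> arrays Z by move=> /domP[b /Xpos[]].
have [x bx] : exists x, arr_b (arr_h X) = key x.
  move: Xt; rewrite (precE bh bt) bm; case: eqVneq => [-> _|_ /=]; first by exists m.
  by move=> /prec_keyP[|x _ ->]; [exact/aZ/domh | exists x].
have := bmax _ Yh; rewrite bx => xY.
have [->|Yx] := eqVneq Y (key x); first by exists x.
have := prec_total Yx; rewrite (negbTE xY) orbF => /prec_keyP[|z _ ->]; last by exists z.
by apply/aZ/domP; exists a.
Qed.

(** * Fundamental sequences and the two Veblen functions *)

Lemma arr_e_arr (s : entries) : s ozero = ozero -> arr_e (array_of s) = array_of s.
Proof. by move=> s0; rewrite /arr_e -key0 coef_arr s0 opred_ozero. Qed.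

Lemma arr_e_key x : arr_e (key x) = if opred x is Some c then key c else key x.
Proof.
rewrite /arr_e coef_key; case: opredP => // c xc.
rewrite -arr_single -key0 remove_arr arr_d_adjoin; last by rewrite fsfun_withE eqxx.
by rewrite upd_upd single_with arr_single.
Qed.

Lemma arr_e_key_succ c : arr_e (key (osucc c)) = key c.
Proof. by rewrite arr_e_key opred_succ. Qed.

Lemma arr_e_key_succN c : (arr_e (key (osucc c)) != key (osucc c)) = true.
Proof.
rewrite arr_e_key_succ; apply/eqP => /key_inj E.
by have := lt_osucc c; rewrite -E ltxx.
Qed.

Lemma opred_lim x : (forall c, c < x -> osucc c < x) -> opred x = None.
Proof.
by move=> xlim; case: opredP => // c xc; have := xlim c; rewrite xc lt_osucc ltxx => /(_ isT).
Qed.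

Lemma arr_fE X : arr_bbar X \in dom X -> arr_f X =
  if X == emptyrel then ozero
  else if arr_e X != X then oone
  else if opred (coef X (arr_bbar X)) is Some _ then
    if arr_e (arr_bbar X) != arr_bbar X then otwo else arr_f (arr_bbar X)
  else coef X (arr_bbar X).
Proof.
move=> bX; rewrite {1}/arr_f wfrecE; last exact: below_dom_wf.
by case: pselect.
Qed.

Lemma arr_gE X a : arr_bbar X \in dom X -> arr_g X a =
  if X == emptyrel then emptyrel
  else if arr_e X != X then arr_e X
  else if opred (coef X (arr_bbar X)) is Some c then
    let X' := adjoin (c, arr_bbar X) (remove X (arr_bbar X)) in
    if arr_e (arr_bbar X) != arr_bbar X then arr_d (adjoin (a, arr_e (arr_bbar X)) X')
    else arr_d (adjoin (oone, arr_g (arr_bbar X) a) X')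
  else arr_d (adjoin (a, arr_bbar X) (remove X (arr_bbar X))).
Proof.
move=> bX; rewrite {1}/arr_g wfrecE; last exact: below_dom_wf.
by case: pselect.
Qed.

Lemma arr_f_key x : x != ozero -> (forall c, c < x -> osucc c < x) -> arr_f (key x) = x.
Proof.
move=> x0 xlim; have ex : arr_e (key x) = key x by rewrite arr_e_key opred_lim.
rewrite arr_fE arr_bbar_key ?empty_dom_key // key_eq0 (negbTE x0) ex eqxx /=.
by rewrite coef_key opred_lim.
Qed.

Lemma arr_g_key x a : x != ozero -> (forall c, c < x -> osucc c < x) ->
  arr_g (key x) a = key a.
Proof.
move=> x0 xlim; have ex : arr_e (key x) = key x by rewrite arr_e_key opred_lim.
rewrite arr_gE arr_bbar_key ?empty_dom_key // key_eq0 (negbTE x0) ex eqxx /=.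
rewrite coef_key opred_lim // -arr_single -key0 remove_arr arr_d_adjoin.
  by rewrite upd_upd single_with arr_single.
by rewrite fsfun_withE eqxx.
Qed.

(** For each of the three cases of [values_succ_succ], [values_lim_succ] and
    [values_lim]: [arr_f], which tells the cases apart and, in the last two,
    bounds the family of equations, and the arrays in these equations. *)
Section FundamentalSequence.
Variable s : entries.
Hypothesis sN : ~ pos_free s.
Local Notation b := (least_pos s).
Let t : entries := [fsfun s with ozero |-> ozero].

Let b_gt0 : ozero < b. Proof. by have [] := least_posP sN. Qed.

Let b_neq0 : (b == ozero) = false. Proof. exact: gt_eqF. Qed.

Let tb : t b = s b. Proof. by rewrite fsfun_withE b_neq0. Qed.

Let sb_neq0 : s b != ozero. Proof. by have [] := least_posP sN. Qed.

Let t_below z : z < b -> t z = ozero.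
Proof.
move=> zb; rewrite fsfun_withE; case: eqVneq => // z0.
by have [_ _] := least_posP sN; apply=> //; rewrite ozero_lt.
Qed.

Let bbar_t : arr_bbar (array_of t) = key b.
Proof. by apply: arr_bbar_arr => //; rewrite tb. Qed.

Let bbar_dom : arr_bbar (array_of t) \in dom (array_of t).
Proof. by rewrite bbar_t dom_arr_key tb. Qed.

Let t_neq0 : (array_of t == emptyrel) = false.
Proof. by apply/negP => /arr_empty/(_ b); rewrite tb; apply/eqP. Qed.

Let e_t : arr_e (array_of t) = array_of t.
Proof. by apply: arr_e_arr; rewrite fsfun_withE eqxx. Qed.

Let arr_ft : arr_f (array_of t) =
  if opred (s b) is Some _ then
    if arr_e (key b) != key b then otwo else arr_f (key b)
  else s b.
Proof. by rewrite arr_fE // t_neq0 e_t eqxx bbar_t coef_arr tb. Qed.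

Let arr_gt a : arr_g (array_of t) a =
  if opred (s b) is Some c then
    let X' := adjoin (c, key b) (array_of [fsfun t with b |-> ozero]) in
    if arr_e (key b) != key b then arr_d (adjoin (a, arr_e (key b)) X')
    else arr_d (adjoin (oone, arr_g (key b) a) X')
  else arr_d (adjoin (a, key b) (array_of [fsfun t with b |-> ozero])).
Proof. by rewrite arr_gE // t_neq0 e_t eqxx bbar_t coef_arr tb remove_arr. Qed.

Let t0_below z : z <= b -> [fsfun t with b |-> ozero] z = ozero.
Proof. by rewrite fsfun_withE le_eqVlt; case: eqVneq => //= _; exact: t_below. Qed.

Let entries_set_with x c w : x < b ->
  [fsfun [fsfun [fsfun t with b |-> ozero] with b |-> c] with x |-> w] = entries_set s x c w.
Proof.
move=> xb; apply: entries_ext => z; rewrite upd_upd 2!fsfun_withE entries_setE.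
case: (z == x) => //; case: ltgtP => [zb|bz|//]; first exact: t_below.
by rewrite fsfun_withE (gt_eqF (lt_trans b_gt0 bz)).
Qed.

Lemma arr_h_entries : arr_h (array_of s) = array_of t.
Proof. exact: arr_h_arr. Qed.

Lemma arr_f_succ_succ h c : b = osucc h -> s b = osucc c -> arr_f (arr_h (array_of s)) = otwo.
Proof. by move=> bh sb; rewrite arr_h_entries arr_ft sb opred_succ bh arr_e_key_succN. Qed.

Lemma arr_g_succ_succ h c a : b = osucc h -> s b = osucc c ->
  arr_g (arr_h (array_of s)) a = array_of (entries_set s h c a).
Proof.
move=> bh sb; have hb : h < b by rewrite bh lt_osucc.
rewrite arr_h_entries arr_gt sb opred_succ /=.
have -> : arr_e (key b) = key h by rewrite bh arr_e_key_succ.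
have -> /= : key h != key b by apply/eqP => /key_inj E; move: hb; rewrite E ltxx.
rewrite arr_d_adjoin2 ?entries_set_with //; first exact/t0_below/ltW.
  exact: t0_below.
by rewrite (lt_eqF hb).
Qed.

Section LimitPosition.
Hypothesis blim : forall x, x < b -> osucc x < b.
Variable c : Ord.
Hypothesis sb : s b = osucc c.

Let e_b : arr_e (key b) = key b. Proof. by rewrite arr_e_key opred_lim. Qed.

Lemma arr_f_lim_succ : arr_f (arr_h (array_of s)) = b.
Proof.
by rewrite arr_h_entries arr_ft sb opred_succ e_b eqxx /= arr_f_key ?b_neq0.
Qed.

Lemma arr_g_lim_succ x w : ozero < x -> x < b ->
  arr_d (adjoin (w, emptyrel) (arr_g (arr_h (array_of s)) x)) =
  array_of [fsfun entries_set s x c oone with ozero |-> w].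
Proof.
move=> x0 xb; rewrite arr_h_entries arr_gt sb opred_succ /= e_b eqxx /=.
rewrite arr_g_key ?b_neq0 // arr_d_adjoin2 ?entries_set_with //; first last.
- by rewrite (lt_eqF xb).
- exact: t0_below.
- exact/t0_below/ltW.
by rewrite -key0 arr_d_adjoin // entries_setE (lt_eqF x0) b_gt0.
Qed.

End LimitPosition.

Section LimitEntry.
Hypothesis slim : forall a, a < s b -> osucc a < s b.

Lemma arr_f_lim : arr_f (arr_h (array_of s)) = s b.
Proof. by rewrite arr_h_entries arr_ft opred_lim. Qed.

Lemma arr_g_lim x w :
  arr_d (adjoin (w, emptyrel) (arr_g (arr_h (array_of s)) x)) = array_of (entries_set s ozero x w).
Proof.
rewrite arr_h_entries arr_gt opred_lim // arr_d_adjoin; last exact: t0_below.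
rewrite -key0 arr_d_adjoin ?entries_set_with //.
by rewrite upd_upd fsfun_withE eq_sym b_neq0 t_below.
Qed.

End LimitEntry.

End FundamentalSequence.

(** The relation along which [phi] recurses. *)
Definition phi_rel (Y X : hrel) : Prop := arrays Y /\ prec (arr_h Y) (arr_h X).

Lemma phi_relP Y s : phi_rel Y (array_of s) <-> exists2 u, pos_lt u s & Y = array_of u.
Proof.
rewrite /phi_rel arr_h_arr; split=> [[aY Ys]|[u [x [x0 us above]] ->]]; last first.
  split; first exact: arrays_arr.
  rewrite arr_h_arr; apply: prec_lex; exists x => [|y xy].
    by rewrite !fsfun_withE (gt_eqF x0).
  by rewrite !fsfun_withE above.
have [u Yu] := arr_below aY Ys; exists u => //.
move: Ys; rewrite Yu arr_h_arr => /lex_prec[x us above].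
(* [arr_h] clears position [ozero], so the decisive position is positive. *)
have x0 : x != ozero by apply: contraTneq us => ->; rewrite !fsfun_withE eqxx ltxx.
exists x; split; first by rewrite ozero_lt.
  by move: us; rewrite !fsfun_withE (negbTE x0).
move=> y xy; have := above y xy; rewrite !fsfun_withE gt_eqF //.
exact: le_lt_trans xy.
Qed.

Lemma phi_rel_acc s : Acc phi_rel (array_of s).
Proof.
by elim: (pos_wf s) => {}s _ IH; split=> Y /phi_relP[u us ->]; exact: IH.
Qed.

Lemma phi_arrE s (rec := fun Y => if pselect (phi_rel Y (array_of s)) then phi Y else ozero) :
  phi (array_of s) =
  if array_of s == emptyrel then oone
  else if dom (array_of s) == [fset emptyrel]%fset then oexp omega (s ozero)
  else enum (veblen_set rec (array_of s)) (s ozero).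
Proof.
rewrite {1}/phi wfrecE; last exact: phi_rel_acc.
by rewrite -[in coef _ emptyrel]key0 coef_arr.
Qed.

Lemma otwo_lt_lim x : x != ozero -> (forall c, c < x -> osucc c < x) -> otwo < x.
Proof. by move=> x0 xlim; apply/xlim/xlim; rewrite ozero_lt. Qed.

Lemma phistar_pos_free s : pos_free s -> phistar s = oexp omega (s ozero).
Proof.
by move=> s0; rewrite phistarE values_pos_free // enum_range //; case: oexp_normal.
Qed.

Lemma dom_pos_free s : dom (array_of s) = [fset emptyrel]%fset -> pos_free s.
Proof.
move=> domE x; rewrite ozero_lt => x0; apply/eqP; apply: contraNT x0 => sx.
by rewrite -dom_arr_key domE inE key_eq0 in sx.
Qed.

(** Only the values of [v] below [s] matter, so [v] may be the guarded recursive
    call in the definition of [phi]. *)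
Lemma veblen_set_values (v : hrel -> Ord) s : ~ pos_free s ->
  (forall u, pos_lt u s -> v (array_of u) = phistar u) -> veblen_set v (array_of s) = values s.
Proof.
move=> sN vE; have [b0 sb0 _] := least_posP sN.
have bN0 : least_pos s != ozero by rewrite -ozero_lt.
rewrite /veblen_set; case: (opredP (s (least_pos s))) => [c sb|slim].
  case: (opredP (least_pos s)) => [h bh|blim].
    rewrite (arr_f_succ_succ sN bh sb) ltxx eqxx (values_succ_succ sN bh sb).
    apply/seteqP; split=> y /=; rewrite (arr_g_succ_succ sN _ bh sb) vE //;
      by apply: pos_lt_set => //; [rewrite bh|rewrite sb]; exact: lt_osucc.
  rewrite (arr_f_lim_succ sN blim sb) otwo_lt_lim // (values_lim_succ sN blim sb).
  have lt x y : ozero < x -> x < least_pos s ->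
      pos_lt [fsfun entries_set s x c oone with ozero |-> y] s.
    move=> x0 xb; have [|z [z0 zs above]] := @pos_lt_set s x c oone sN xb.
      by rewrite sb lt_osucc.
    exists z; split=> //; first by rewrite fsfun_withE (gt_eqF z0).
    by move=> w zw; rewrite fsfun_withE (gt_eqF (lt_trans z0 zw)) above.
  apply/seteqP; split=> y /= yP x x0 xb; have := yP x x0 xb;
    by rewrite (arr_g_lim_succ sN blim sb) // vE //; exact: lt.
rewrite (arr_f_lim sN slim) otwo_lt_lim // (values_lim sN slim).
apply/seteqP; split=> y /= yP x x0 xs; have := yP x x0 xs;
  by rewrite (arr_g_lim sN slim) vE //; exact: pos_lt_set.
Qed.

Lemma phi_arr s : phi (array_of s) = phistar s.
Proof.
elim: (pos_wf s) => {}s _ IH; rewrite phi_arrE.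
case: ifP => [/arr_empty s0|/negP sN0].
  by rewrite phistar_pos_free ?s0 ?oexp0 // => x _.
case: ifPn => [/eqP/dom_pos_free s0|domN]; first by rewrite phistar_pos_free.
have sN : ~ pos_free s.
  move=> s0; have s00 : s ozero != ozero.
    apply/eqP => s00; apply: sN0; apply/arr_empty => x.
    by have [->//|x0] := eqVneq x ozero; apply: s0; rewrite ozero_lt.
  move/eqP: domN; apply; apply/fsetP => Y; rewrite inE; apply/idP/eqP => [|->].
    move=> /dom_arr[x sx ->]; apply/eqP; rewrite key_eq0.
    by apply: contraNT sx => x0; rewrite s0 ?ozero_lt.
  by rewrite -key0 dom_arr_key.
rewrite phistarE (veblen_set_values sN) // => u us.
case: pselect => [?|[]] /=; first exact: IH.
by apply/phi_relP; exists u.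
Qed.

Lemma entries_ofE n (al be : 'I_n -> Ord) i : injective be ->
  entries_of al be (be i) = al i.
Proof.
move=> be_inj; rewrite /entries_of fsfunE.
have -> : be i \in [fset be i | i : 'I_n]%fset by apply/imfsetP; exists i.
by case: pickP => [j /eqP/be_inj -> //|/(_ i)]; rewrite eqxx.
Qed.

Lemma entries_of_supp n (al be : 'I_n -> Ord) x :
  entries_of al be x != ozero -> exists i, x = be i.
Proof.
rewrite /entries_of fsfunE; case: ifP => [/imfsetP[i _ ->] _|]; first by exists i.
by rewrite eqxx.
Qed.

Lemma arr_d_entries_of n (al be : 'I_n -> Ord) : injective be ->
  arr_d (rel_of [fset (al i, underline (be i)) | i : 'I_n]%fset) = array_of (entries_of al be).
Proof.
move=> be_inj; apply: arr_d_eq => [a Y|x sx]; rewrite elts_rel_of.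
  move=> /imfsetP[i _ [-> ->]] _; exists (be i); rewrite ?entries_ofE //.
  exact: arr_d_underline.
have [i xi] := entries_of_supp sx; exists (underline (be i)); rewrite xi.
  by apply/imfsetP; exists i; rewrite ?entries_ofE.
exact: arr_d_underline.
Qed.

Theorem theorem3p15 (n : nat) (al be : 'I_n.+1 -> Ord) (be_inj : injective be) :
  phi (arr_d (rel_of [fset (al i, underline (be i)) | i : 'I_n.+1]%fset))
  = phistar (entries_of al be).
Proof. by rewrite arr_d_entries_of // phi_arr. Qed.
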